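(* Let $n\geq 3$, and for $c\in\mathbb{R}_{>0}$ let $g^c_n$ be the Lorentzian metric on $\mathbb{R}^n$ defined in the context. The following statements hold for all $c\in\mathbb{R}_{>0}$: (1) The diffeomorphism $\varphi_c\colon\mathbb{R}^n\to\mathbb{R}^n$ given by $(x_0,x_1,x_2,\dots,x_{n-1})\mapsto(c^2x_0,cx_1,cx_2,\dots,cx_{n-1})$ satisfies $g^c_n=\frac{1}{c^2}\varphi_c^\ast(g^1_n)$; thus $c^2g^c_n$ is isometric to $g^1_n$. (2) $g^c_n$ is geodesically complete. (3) $g^c_n$ has no closed causal geodesic. But for every $p\in\mathbb{R}^n$, there is a $1$-parameter family of closed spacelike geodesics through $p$. (4) Let $I\subseteq\mathbb{R}$ be a compact interval, and let $r\in\mathbb{N}_{\geq1}\cup\{\infty\}$. Then every $g^c_3$-timelike $C^r$ path $I\to\mathbb{R}^3$ admits an extension to a closed $g^c_3$-timelike $C^r$ path. Hence there exist for every $p\in\mathbb{R}^n$ closed $g^c_n$-timelike paths through $p$. (5) $g^c_n$ satisfies the timelike convergence condition and, for all $\Lambda\leq\frac{c^2}{4}$, the dominant energy condition with respect to the cosmological constant $\Lambda$.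
   Context: Definition of $g^c_n$: for $c>0$ consider on $\mathbb{R}^3$ with coordinates $(x_0,x_1,x_2)$ and $\partial_i=\partial/\partial x_i$ the frame $e_0=\frac1c\partial_0$, $e_1=\partial_1-x_2\partial_0$, $e_2=\partial_2$. The Lorentzian metric $g^c_3$ on $\mathbb{R}^3$ is defined by $g^c_3(e_i,e_j)=\varepsilon_i\delta_{ij}$ with $\varepsilon_0=-1$, $\varepsilon_1=\varepsilon_2=1$. For $n\geq3$, $g^c_n$ on $\mathbb{R}^n=\mathbb{R}^3\times\mathbb{R}^{n-3}$ is the product of $g^c_3$ with the euclidean Riemannian metric on $\mathbb{R}^{n-3}$. A vector $v$ is timelike if $g(v,v)<0$, lightlike if $g(v,v)=0$ and $v\neq0$, causal if timelike or lightlike, spacelike if $g(v,v)>0$. A path is timelike if its velocity is everywhere timelike. A closed geodesic is a nonconstant periodic geodesic. A $C^r$ path $w\colon[\alpha,\beta]\to\mathbb{R}^n$ is closed if its start and end points agree and it closes up as a $C^r$ loop (for $r=1$: $w(\alpha)=w(\beta)$ and $w'(\alpha)=w'(\beta)$). A Lorentzian metric $g$ satisfies the timelike convergence condition iff $\mathrm{Ric}_g(v,v)\geq0$ for all timelike $v$. For $\Lambda\in\mathbb{R}$, the energy-momentum tensor with respect to $\Lambda$ is $T=\mathrm{Ric}_g-\frac12\mathrm{scal}_g\,g+\Lambda g$. The dominant energy condition with respect to $\Lambda$ holds iff for every timelike $v$ one has $T(v,v)\geq0$ and the vector $-\sharp(T(v,\cdot))$ is not spacelike, where $\sharp\colon T^\ast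 M\to TM$ is the isomorphism induced by $g$. *)

(* Defs.v *)
From HB Require Import structures.
From mathcomp Require Import all_boot all_order all_algebra.
From mathcomp Require Import all_classical all_reals all_analysis.

Set Implicit Arguments.
Unset Strict Implicit.
Unset Printing Implicit Defensive.
Import Order.TTheory GRing.Theory Num.Theory.
Import numFieldNormedType.Exports.
Local Open Scope classical_set_scope.
Local Open Scope ring_scope.

(** * Smooth maps *)

Definition iter_deriv (R : realType) (V W : normedModType R)
    (vs : seq V) (f : V -> W) : V -> W :=
  foldr (fun v h => fun x => 'D_v h x) f vs.

(* C^oo on an open subset [A] of a finite-dimensional space [V]: all iterated
   directional derivatives exist and are continuous on [A]. *)
Definition smooth_on (R : realType) (V W : normedModType R)
    (A : set V) (f : V -> W) : Prop :=
  forall (vs : seq V) (x : V), A x ->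
    (forall v : V, derivable (iter_deriv vs f) x v) /\
    {for x, continuous (iter_deriv vs f)}.

Definition diffeomorphism (R : realType) (N : nat)
    (phi : 'rV[R]_N -> 'rV[R]_N) : Prop :=
  smooth_on setT phi /\
  exists psi : 'rV[R]_N -> 'rV[R]_N,
    [/\ smooth_on setT psi, cancel phi psi & cancel psi phi].

(** * C^r paths on compact intervals *)

(* Regularities r in N u {oo}: [Some k] is k and [None] is oo. *)
Definition regularity := option nat.

Definition reg_le (k : nat) (r : regularity) : bool :=
  if r is Some l then (k <= l)%N else true.

Section Paths.
Variables (R : realType) (N : nat).
Implicit Types (D : set R) (w : R -> 'rV[R]_N).

(* Difference quotients within [D], so that derivatives at the end points of a
   compact interval are one-sided and only the values of [w] on [D] matter. *)
Definition quotient D w (t : R) : set_system 'rV[R]_N :=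
  (fun s : R => (s - t)^-1 *: (w s - w t)) @ within D (t^').

Definition derive_within D w : R -> 'rV[R]_N :=
  fun t => lim (quotient D w t).

Definition derive_within_n D (k : nat) w : R -> 'rV[R]_N :=
  iter k (derive_within D) w.

Definition Cr_path (r : regularity) (a b : R) w : Prop :=
  forall k : nat,
    (reg_le k.+1 r -> forall t, a <= t <= b ->
       cvg (quotient `[a, b] (derive_within_n `[a, b] k w) t)) /\
    (reg_le k r -> {within `[a, b], continuous (derive_within_n `[a, b] k w)}).

Definition closes_up (r : regularity) (a b : R) w : Prop :=
  forall k : nat, reg_le k r ->
    derive_within_n `[a, b] k w a = derive_within_n `[a, b] k w b.

End Paths.

(** * Pseudo-Riemannian geometry of R^N in the standard coordinates *)

(* A (0,2)-tensor field [G] is given by its matrices (G x) i j = G_x(d_i, d_j);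
   tangent vectors are row vectors. *)
Section Metric.
Variables (R : realType) (N : nat).
Implicit Types (G : 'rV[R]_N -> 'M[R]_N) (x v w : 'rV[R]_N).

Definition ev2 G x v w : R := (v *m G x *m w^T) 0 0.

Definition timelike G x v : Prop := ev2 G x v v < 0.
Definition lightlike G x v : Prop := ev2 G x v v = 0 /\ v != 0.
Definition causal G x v : Prop := timelike G x v \/ lightlike G x v.
Definition spacelike G x v : Prop := 0 < ev2 G x v v.

(* (phi^* G)_x(v, w) = G_(phi x)('d phi x v, 'd phi x w), where
   'd phi x v = v *m 'J phi x. *)
Definition pullback (phi : 'rV[R]_N -> 'rV[R]_N) G : 'rV[R]_N -> 'M[R]_N :=
  fun x => 'J phi x *m G (phi x) *m ('J phi x)^T.

Definition isometric G (H : 'rV[R]_N -> 'M[R]_N) : Prop :=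
  exists phi : 'rV[R]_N -> 'rV[R]_N,
    diffeomorphism phi /\ forall x, G x = pullback phi H x.

Definition partial (i : 'I_N) (f : 'rV[R]_N -> R) (x : 'rV[R]_N) : R :=
  'D_(delta_mx 0 i) f x.

(* Gamma^k_(ij) of the Levi-Civita connection. *)
Definition christoffel G (k i j : 'I_N) x : R :=
  2^-1 * \sum_(l < N) invmx (G x) k l *
    (partial i (fun y => G y j l) x + partial j (fun y => G y i l) x
     - partial l (fun y => G y i j) x).

(* The component dx^l (Riem(d_i, d_j) d_k), with
   Riem(X, Y) Z = nabla_X nabla_Y Z - nabla_Y nabla_X Z - nabla_[X,Y] Z. *)
Definition riemann G (l k i j : 'I_N) x : R :=
  partial i (christoffel G l j k) x - partial j (christoffel G l i k) x
  + \sum_(p < N) (christoffel G l i p x * christoffel G p j k x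
                  - christoffel G l j p x * christoffel G p i k x).

(* Ric(Y, Z) = trace of X |-> Riem(X, Y) Z. *)
Definition ricci G x : 'M[R]_N :=
  \matrix_(j, k) \sum_(i < N) riemann G i k i j x.

Definition scal G x : R :=
  \sum_(i < N) \sum_(j < N) invmx (G x) i j * ricci G x i j.

Definition is_geodesic G (J : set R) (gamma : R -> 'rV[R]_N) : Prop :=
  smooth_on J gamma /\
  forall t, J t -> forall k : 'I_N,
    derive1 (derive1 gamma) t 0 k
    + \sum_(i < N) \sum_(j < N)
        christoffel G k i j (gamma t) * derive1 gamma t 0 i * derive1 gamma t 0 j = 0.

Definition geodesically_complete G : Prop :=
  forall (J : set R) (gamma : R -> 'rV[R]_N),
    is_interval J -> open J -> is_geodesic G J gamma ->
    exists delta : R -> 'rV[R]_N,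
      is_geodesic G setT delta /\ forall t, J t -> delta t = gamma t.

Definition closed_geodesic G (gamma : R -> 'rV[R]_N) : Prop :=
  [/\ is_geodesic G setT gamma,
      exists2 T : R, 0 < T & forall t, gamma (t + T) = gamma t &
      exists s t, gamma s <> gamma t].

Definition causal_curve G (gamma : R -> 'rV[R]_N) : Prop :=
  forall t, causal G (gamma t) (derive1 gamma t).

Definition spacelike_curve G (gamma : R -> 'rV[R]_N) : Prop :=
  forall t, spacelike G (gamma t) (derive1 gamma t).

(* A family indexed by a nonempty open interval which is jointly smooth and
   whose members are geometrically (not just as parametrized curves) distinct. *)
Definition family_of_closed_spacelike_geodesics_through G
    (p : 'rV[R]_N) : Prop :=
  exists (a b : R) (Gam : R -> R -> 'rV[R]_N),
    [/\ a < b,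
        smooth_on [set st : R * R | a < st.1 < b]
          (fun st : R * R => Gam st.1 st.2),
        forall s, a < s < b ->
          [/\ closed_geodesic G (Gam s), spacelike_curve G (Gam s) &
              exists t, Gam s t = p] &
        forall s s', a < s < b -> a < s' < b -> s <> s' ->
          range (Gam s) <> range (Gam s')].

Definition timelike_path G (r : regularity) (a b : R) (w : R -> 'rV[R]_N) :
    Prop :=
  Cr_path r a b w /\
  forall t, a <= t <= b -> timelike G (w t) (derive_within `[a, b] w t).

Definition closed_timelike_path G (r : regularity) (a b : R)
    (w : R -> 'rV[R]_N) : Prop :=
  timelike_path G r a b w /\ closes_up r a b w.

Definition timelike_convergence G : Prop :=
  forall x v, timelike G x v -> 0 <= ev2 (ricci G) x v v.

Definition energy_momentum G (Lambda : R) x : 'M[R]_N :=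
  ricci G x - (2^-1 * scal G x) *: G x + Lambda *: G x.

(* The vector w with G_x(w, .) = alpha, for a covector alpha with components
   alpha(d_i) = alpha 0 i. *)
Definition sharp G x (alpha : 'rV[R]_N) : 'rV[R]_N := alpha *m invmx (G x).

Definition dominant_energy G (Lambda : R) : Prop :=
  forall x v, timelike G x v ->
    0 <= ev2 (energy_momentum G Lambda) x v v /\
    ~ spacelike G x (- sharp G x (v *m energy_momentum G Lambda x)).

End Metric.

(** * The metrics g^c_n *)

Section StandardMetrics.
Variable R : realType.
Implicit Types (c : R).

Definition i0 : 'I_3 := @Ordinal 3 0 isT.
Definition i1 : 'I_3 := @Ordinal 3 1 isT.
Definition i2 : 'I_3 := @Ordinal 3 2 isT.

Definition pd (i : 'I_3) : 'rV[R]_3 := delta_mx 0 i.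

(* The rows are the frame vectors e_0, e_1, e_2 at [x]. *)
Definition frame c (x : 'rV[R]_3) : 'M[R]_3 :=
  \matrix_(i < 3) nth 0 [:: c^-1 *: pd i0; pd i1 - x 0 i2 *: pd i0; pd i2] i.

Definition eps : 'rV[R]_3 := \row_(i < 3) (if i == i0 then -1 else 1).

(* The unique solution of frame *m g3 *m frame^T = diag eps; see [g3_frame]. *)
Definition g3 c (x : 'rV[R]_3) : 'M[R]_3 :=
  invmx (frame c x) *m diag_mx eps *m (invmx (frame c x))^T.

(* n = 3 + m; the product of g3 with the euclidean metric of R^m. *)
Definition g c (m : nat) (x : 'rV[R]_(3 + m)) : 'M[R]_(3 + m) :=
  block_mx (g3 c (lsubmx x)) 0 0 1%:M.

Definition phi c (m : nat) (x : 'rV[R]_(3 + m)) : 'rV[R]_(3 + m) :=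
  \row_(i < 3 + m) ((if i == 0%N :> nat then c ^+ 2 else c) * x 0 i).

Lemma frame_unit c x : 0 < c -> frame c x \in unitmx.
Proof.
move=> c0; rewrite unitmxE det_trig.
  rewrite !big_ord_recl big_ord0 !mxE /= ?mxE /= unitfE.
  by rewrite !(mulr1, mulr0, subr0) invr_eq0 gt_eqF.
apply/is_trig_mxP => -[[|[|[|i]]] hi] [[|[|[|j]]] hj] //= _;
  by rewrite !mxE /= ?mxE /= ?(mulr0, subr0).
Qed.

Lemma g3_frame c x (i j : 'I_3) : 0 < c ->
  ev2 (g3 c) x (row i (frame c x)) (row j (frame c x)) = eps 0 i *+ (i == j).
Proof.
move=> c0; have Fu := frame_unit x c0.
have -> : ev2 (g3 c) x (row i (frame c x)) (row j (frame c x)) =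
    (frame c x *m g3 c x *m (frame c x)^T) i j.
  by rewrite /ev2 -row_mul tr_row !mxE; apply: eq_bigr => k _; rewrite !mxE.
rewrite /g3 -!mulmxA -trmx_mul mulmxV // trmx1 mulmx1 mulmxA mulmxV // mul1mx.
by rewrite mxE.
Qed.

End StandardMetrics.

Arguments g {R} c m x.
Arguments phi {R} c m x.

(* Main.v *)
(** Along a geodesic u = x0' + x2 x1' is constant and, with w = c^2 u, the planar part
    satisfies x1'' = w x2', x2'' = - w x1'; hence it is a circle or a line, x0 is
    explicit, and geodesics are complete. Periodicity of x0 forces
    x1'^2 + x2'^2 = 2 (c u)^2, so that closed geodesics are spacelike; conversely the
    planar circles of radius sqrt 2 / c lift to closed geodesics, and the circles
    through a point form the family.

    A path is timelike iff x1'^2 + x2'^2 < c^2 u^2, and x0 changes by the integral of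
    u - x2 x1'. Beyond its right end a timelike path is continued by smooth functions
    with the prescribed jets at both ends (Borel's lemma). A drift r^2 in the direction
    of e0 makes the transition between the two jets timelike for large r, and a planar
    loop of size r, whose velocity is only O(r) but whose enclosed area is r^2,
    brings x0 back.

    In the frame e_0, ..., e_(n-1) the metric, its Ricci tensor and the energy-momentum
    tensor are diagonal, with Ricci eigenvalues c^2 / 2 (three times) and 0. *)

Require Import Defs.
From mathcomp Require Import all_boot all_order all_algebra.
From mathcomp Require Import all_classical all_reals all_analysis.
From mathcomp Require Import ring lra.
Import Order.TTheory GRing.Theory Num.Theory.
Import numFieldNormedType.Exports.
Local Open Scope classical_set_scope.
Local Open Scope ring_scope.

Set Implicit Arguments.
Unset Strict Implicit.
Unset Printing Implicit Defensive.

(** * Smooth functions *)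

(** The paths to be closed are C^r with r finite or infinite, their derivatives one-sided and
    undefined off the interval. One device treats all r alike: a path is handled through the
    sequence of its derivatives, and Borel's lemma realises any sequence of values at an end point
    by a smooth function. Blending the two end jets by cut-offs ruins timelikeness in the middle. A
    drift can repair this only if u has the same sign at both ends; this holds because u is
    continuous and never zero along the given path. The sides of the area loop are run through one
    at a time, so that its effect on x0 is the derivative of a single ramp and can be cancelled at
    each instant, not merely after integration. The factor 2 in the condition for closed geodesics
    is an area condition: a circle of radius rho run through at rate w = c^2 u has period 2 pi / w,
    and x0 returns iff u times the period equals the enclosed area pi rho^2, that is rho^2 = 2 /
    c^2. The bound c^2 / 4 on Lambda is half the scalar curvature, since T = Ric + (Lambda - c^2 /
    4) g. *)

Section SmoothFunctions.
Context {R : realType}.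

Section Scalar.
Context {V : normedModType R}.
Implicit Types (f g : V -> R) (n : nat).

(** Differentiability, not just existence of directional derivatives, is demanded at each level
    because the chain rule needs it; the recursion through ['D_v] matches that of [iter_deriv]. *)
Fixpoint diff_class n f : Prop :=
  if n is n'.+1 then
    (forall x, differentiable f x) /\ forall v, diff_class n' ('D_v f)
  else True.

Definition smooth f : Prop := forall n, diff_class n f.

Lemma diff_classS n f : diff_class n.+1 f -> diff_class n f.
Proof. by elim: n f => // n IH f [df Hf]; split=> // v; exact/IH/Hf. Qed.

Lemma diff_class_cst n k : diff_class n (cst k : V -> R).
Proof.
elim: n k => // n IH k; split=> [x|v]; first exact: differentiable_cst.
rewrite (_ : 'D_v _ = cst 0); first exact: IH.
by apply/funext => x; exact: derive_cst.
Qed.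

Lemma diff_classD n f g :
  diff_class n f -> diff_class n g -> diff_class n (fun x => f x + g x).
Proof.
elim: n f g => // n IH f g [df Hf] [dg Hg]; split=> [x|v].
  exact: differentiableD.
rewrite (_ : 'D_v _ = fun x => 'D_v f x + 'D_v g x).
  by apply: IH; [exact: Hf|exact: Hg].
by apply/funext => x; apply: deriveD; exact: diff_derivable.
Qed.

Lemma diff_classM n f g :
  diff_class n f -> diff_class n g -> diff_class n (fun x => f x * g x).
Proof.
elim: n f g => // n IH f g cf cg.
have [df Hf] := cf; have [dg Hg] := cg; split=> [x|v].
  exact: differentiableM.
rewrite (_ : 'D_v _ = fun x => f x * 'D_v g x + g x * 'D_v f x).
  apply: diff_classD; apply: IH;
    by [exact: diff_classS|exact: Hf|exact: Hg].
by apply/funext => x; apply: deriveM; exact: diff_derivable.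
Qed.

Lemma derive_scalar_comp (h : R -> R) f x v :
  differentiable h (f x) -> differentiable f x ->
  'D_v (fun y => h (f y)) x = h^`()%classic (f x) * 'D_v f x.
Proof.
move=> dh df; rewrite deriveE; last exact: (differentiable_comp df dh).
rewrite (diff_comp df dh) /= -(deriveE v df) (diff1E dh) /=.
by rewrite mulrC.
Qed.

Lemma smooth_cst k : smooth (cst k : V -> R).
Proof. by move=> n; exact: diff_class_cst. Qed.

Lemma smoothD f g : smooth f -> smooth g -> smooth (fun x => f x + g x).
Proof. by move=> sf sg n; exact: diff_classD. Qed.

Lemma smoothM f g : smooth f -> smooth g -> smooth (fun x => f x * g x).
Proof. by move=> sf sg n; exact: diff_classM. Qed.

Lemma smoothZ k f : smooth f -> smooth (fun x => k * f x).
Proof. by apply: smoothM; exact: smooth_cst. Qed.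

Lemma smoothN f : smooth f -> smooth (fun x => - f x).
Proof.
move=> sf; rewrite (_ : (fun _ => _) = fun x => cst (-1) x * f x).
  by apply: smoothM => //; exact: smooth_cst.
by apply/funext => x; rewrite /= mulN1r.
Qed.

Lemma smoothB f g : smooth f -> smooth g -> smooth (fun x => f x - g x).
Proof. by move=> sf sg; apply: smoothD => //; exact: smoothN. Qed.

Lemma smooth_sum (I : Type) (r : seq I) (F : I -> V -> R) :
  (forall i, smooth (F i)) -> smooth (fun x => \sum_(i <- r) F i x).
Proof.
move=> sF; elim: r => [|i r IH].
  rewrite (_ : (fun _ => _) = cst 0); first exact: smooth_cst.
  by apply/funext => x; rewrite big_nil.
rewrite (_ : (fun _ => _) = fun x => F i x + \sum_(i <- r) F i x).
  exact: smoothD.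
by apply/funext => x; rewrite big_cons.
Qed.

Lemma smooth_differentiable f x : smooth f -> differentiable f x.
Proof. by case/(_ 1%N). Qed.

Lemma smooth_derivable f x v : smooth f -> derivable f x v.
Proof. by move=> sf; exact/diff_derivable/smooth_differentiable. Qed.

Lemma smooth_continuous f : smooth f -> continuous f.
Proof.
by move=> sf x; exact/differentiable_continuous/smooth_differentiable.
Qed.

Lemma smooth_derive f v : smooth f -> smooth ('D_v f).
Proof. by move=> sf n; have [_] := sf n.+1; apply. Qed.

Lemma smooth_affine f :
  (forall x, differentiable f x) -> (forall v, exists k, forall x, 'D_v f x = k) ->
  smooth f.
Proof.
move=> df Df [//|n]; split=> // v; have [k kE] := Df v.
by rewrite (_ : 'D_v f = cst k); [exact: diff_class_cst|exact/funext].
Qed.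

Lemma smooth_linear (f : {linear V -> R}) : continuous f -> smooth f.
Proof.
move=> cf; apply: smooth_affine => [x|v]; first exact: linear_differentiable.
exists (f v) => x; rewrite deriveE; last exact: linear_differentiable.
by rewrite diff_lin.
Qed.

End Scalar.

Lemma diff_class_comp {V : normedModType R} n (h : R -> R) (f : V -> R) :
  diff_class n h -> diff_class n f -> diff_class n (fun x => h (f x)).
Proof.
elim: n h f => // n IH h f ch cf.
have [dh Hh] := ch; have [df Hf] := cf; split=> [x|v].
  exact: (differentiable_comp (df x) (dh (f x))).
rewrite (_ : 'D_v _ = fun x => ('D_1 h) (f x) * 'D_v f x).
  apply: diff_classM; last exact: Hf.
  by apply: (IH ('D_1 h)); [exact: Hh|exact: diff_classS].
by apply/funext => x; rewrite -derive1E; exact: derive_scalar_comp.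
Qed.

Lemma smooth_comp {V : normedModType R} (h : R -> R) (f : V -> R) :
  smooth h -> smooth f -> smooth (fun x => h (f x)).
Proof. by move=> sh sf n; exact: diff_class_comp. Qed.

(** The derivative - f' / f^2 involves f only through 1/f and f', so order n for 1/f gives order n +
    1. *)
Lemma smoothV {V : normedModType R} (f : V -> R) :
  (forall x, f x != 0) -> smooth f -> smooth (fun x => (f x)^-1).
Proof.
move=> f0 sf n; elim: n => // n IH; split=> [x|v].
  by apply: differentiableV => //; exact: smooth_differentiable.
rewrite (_ : 'D_v _ = fun x => cst (-1) x * ((f x)^-1 * (f x)^-1 * 'D_v f x)).
  apply: diff_classM; first exact: diff_class_cst.
  by apply: diff_classM; [exact: diff_classM|exact: smooth_derive].
apply/funext => x; rewrite deriveV//; last exact: smooth_derivable.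
by rewrite /= mulN1r [LHS]mulNr expr2 invfM.
Qed.

Lemma smooth_id : smooth (id : R -> R).
Proof.
apply: smooth_affine => [x|v]; first exact/derivable1_diffP/derivable_id.
by exists v => x; exact: derive_id.
Qed.

Lemma deriveE_scale (f : R -> R) x v : derivable f x 1 -> 'D_v f x = v * f^`()%classic x.
Proof.
by move=> /derivable1_diffP df; rewrite deriveE// (diff1E df).
Qed.

(** Smoothness is certified by a list of candidate derivatives. This serves the sine, whose
    derivatives repeat with period four, and the sum in [borel]. *)
Lemma smooth_tower (F : nat -> R -> R) :
  (forall k (x : R), is_derive x (1 : R) (F k) (F k.+1 x)) -> forall k, smooth (F k).
Proof.
move=> dF k n; elim: n k => // n IH k; split=> [x|v].
  by apply/derivable1_diffP; case: (dF k x).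
rewrite (_ : 'D_v _ = fun x => cst v x * F k.+1 x).
  by apply: diff_classM => //; exact: diff_class_cst.
apply/funext => x; rewrite deriveE_scale; last by case: (dF k x).
by rewrite derive1E; case: (dF k x) => _ ->.
Qed.

Lemma smooth_derive1n (f : R -> R) k : smooth f -> smooth f^`(k)%classic.
Proof.
elim: k => // k IH sf; rewrite derive1nS.
rewrite (_ : _^`()%classic = 'D_1 f^`(k)%classic); first by apply: smooth_derive; exact: IH.
by apply/funext => x; rewrite derive1E.
Qed.

Lemma smooth_is_derive (f : R -> R) k x : smooth f ->
  is_derive x (1 : R) f^`(k)%classic (f^`(k.+1)%classic x).
Proof.
move=> sf; rewrite derive1nS derive1E; apply/derivableP/smooth_derivable.
exact: smooth_derive1n.
Qed.

Lemma derive1n_tower (F : nat -> R -> R) k :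
  (forall k (x : R), is_derive x (1 : R) (F k) (F k.+1 x)) -> (F 0%N)^`(k)%classic = F k.
Proof.
move=> dF; elim: k => // k IH; rewrite derive1nS IH.
by apply/funext => x; rewrite derive1E; case: (dF k x).
Qed.

Lemma smooth_sin : smooth (@sin R).
Proof.
pose F k := nth (@sin R) [:: @sin R; @cos R; -%R \o @sin R; -%R \o @cos R] (k %% 4).
apply: (smooth_tower (F := F) _ 0%N) => k x; rewrite /F -(addn1 k) -(modnDml k).
case: (k %% 4)%N (ltn_pmod k (isT : (0 < 4)%N)) => [|[|[|[|//]]]] _ /=.
- exact: is_derive_sin.
- exact: is_derive_cos.
- by apply: is_deriveN; exact: is_derive_sin.
- by rewrite -[sin x]opprK; apply: is_deriveN; exact: is_derive_cos.
Qed.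

Lemma smooth_cos : smooth (@cos R).
Proof.
rewrite (_ : @cos R = 'D_1 (@sin R)); first exact/smooth_derive/smooth_sin.
by apply/funext => x; rewrite derive_val.
Qed.

Lemma derive_coord N (i : 'I_N) (x v : 'rV[R]_N) :
  'D_v (fun x : 'rV[R]_N => x 0 i) x = v 0 i.
Proof.
have := derive_mx (@derivable_id R _ x v).
by rewrite derive_id => /matrixP/(_ 0 i); rewrite mxE.
Qed.

Lemma smooth_coord N (i : 'I_N) : smooth (fun x : 'rV[R]_N => x 0 i).
Proof.
apply: smooth_affine => [x|v]; first exact: differentiable_coord.
by exists (v 0 i) => x; exact: derive_coord.
Qed.

Lemma smooth_fst : smooth (fun st : R * R => st.1).
Proof. by apply: smooth_linear => z; exact: cvg_fst. Qed.

Lemma smooth_snd : smooth (fun st : R * R => st.2).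
Proof. by apply: smooth_linear => z; exact: cvg_snd. Qed.

(** * Vector-valued maps, componentwise *)

Section RowValued.
Context {V : normedModType R} {N : nat}.
Implicit Type f : V -> 'rV[R]_N.

Lemma smooth_row_derivable f x v :
  (forall i, smooth (fun y => f y 0 i)) -> derivable f x v.
Proof.
by move=> sf; apply/derivable_mxP => i j; rewrite ord1; exact: smooth_derivable.
Qed.

Lemma cvg_row (T : Type) (F : set_system T) (h : T -> 'rV[R]_N) (l : 'rV[R]_N) :
  Filter F -> (forall i, h x 0 i @[x --> F] --> l 0 i) -> h @ F --> l.
Proof.
move=> FF hl; apply/cvgrPdist_le => /= e e0; near=> x.
rewrite /Num.Def.normr/= mx_normrE (bigmax_le _ (ltW e0))//= => -[i j] _.
rewrite !mxE/= ord1; move: j {i}; near: x; apply: filter_forall => /= j.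
by have /cvgrPdist_le := hl j; exact.
Unshelve. all: by end_near. Qed.

Lemma cvg_rowP (T : Type) (F : set_system T) (h : T -> 'rV[R]_N) (l : 'rV[R]_N) :
  Filter F -> h @ F --> l <-> forall i, h x 0 i @[x --> F] --> l 0 i.
Proof.
move=> FF; split=> [hl i|]; last exact: cvg_row.
exact: (cvg_comp h _ hl (@coord_continuous R 1 N 0 i l)).
Qed.

Lemma iter_deriv_row f vs :
  (forall i, smooth (fun y => f y 0 i)) ->
  forall i, smooth (fun y => iter_deriv vs f y 0 i).
Proof.
move=> sf; elim: vs => //= v vs IH i.
rewrite (_ : (fun _ => _) = 'D_v (fun y => iter_deriv vs f y 0 i)).
  exact/smooth_derive/IH.
apply/funext => x; rewrite derive_mx; last exact: smooth_row_derivable.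
by rewrite mxE.
Qed.

Lemma smooth_on_row (A : set V) f :
  (forall i, smooth (fun y => f y 0 i)) -> smooth_on A f.
Proof.
move=> sf vs x _; have sfv := iter_deriv_row vs sf.
split=> [v|]; first exact: smooth_row_derivable.
by apply: cvg_row => i; exact: smooth_continuous.
Qed.

End RowValued.

End SmoothFunctions.

(** * Flat functions and Borel's lemma *)

Section FlatAndBorel.
Context {R : realType}.

Lemma is_derive_eps (f : R -> R) x l :
  (forall e, 0 < e -> exists2 d, 0 < d &
     forall h, h != 0 -> `|h| < d -> `|l - h^-1 * (f (h + x) - f x)| <= e) ->
  is_derive x (1 : R) f l.
Proof.
move=> H.
have fl : (fun h : R => h^-1 *: ((f \o shift x) (h *: (1 : R)) - f x)) @ 0^' --> l.
  apply/cvgrPdist_le => /= e /H[d d0 Hd].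
  exists d => //= h; rewrite /ball_ /= sub0r normrN => hd h0.
  by rewrite [h%:A]mulr1; exact: Hd.
by apply: DeriveDef; [apply/cvg_ex; exists l|exact: cvg_lim].
Qed.

Lemma is_derive_continuous (f : R -> R) x l :
  is_derive x (1 : R) f l -> {for x, continuous f}.
Proof. by case=> df _; exact/differentiable_continuous/derivable1_diffP. Qed.

(** By the mean value theorem the difference quotient at [x0] equals [df z] for some z between [x0]
    and [x0 + h], and [df] is continuous at [x0]. It supplies the derivative of the Borel sum at
    0. *)
Lemma is_derive_of_cvg (f df : R -> R) x0 :
  (forall x, x != x0 -> is_derive x (1 : R) f (df x)) ->
  {for x0, continuous f} -> {for x0, continuous df} ->
  is_derive x0 (1 : R) f (df x0).
Proof.
move=> fdf cf cdf; apply: is_derive_eps => e e0.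
have /cvgrPdist_le/(_ e e0)[d /= d0 Hd] := cdf.
exists d => // h h0 hd.
have cf' : continuous f.
  move=> x; have [->|xx0] := eqVneq x x0; first exact: cf.
  exact: (is_derive_continuous (fdf x xx0)).
have [h_gt0|h_lt0|/eqP] := ltgtP h 0; last by rewrite (negbTE h0).
  have hx : h + x0 < x0 by lra.
  have [z|//|z /[!in_itv]/= /andP[z1 z2] E] := MVT (f := f) (df := df) hx.
  - by rewrite in_itv/= => /andP[z1 z2]; apply: fdf; rewrite lt_eqF.
  - exact: continuous_subspaceT.
  - have -> : f (h + x0) - f x0 = df z * h by lra.
    rewrite mulrCA mulVf// mulr1; apply: Hd; rewrite /= /ball_/=.
    by move: hd; rewrite !ltr_norml; lra.
have hx : x0 < h + x0 by lra.
have [z|//|z /[!in_itv]/= /andP[z1 z2] E] := MVT (f := f) (df := df) hx.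
- by rewrite in_itv/= => /andP[z1 z2]; apply: fdf; rewrite gt_eqF.
- exact: continuous_subspaceT.
- have -> : f (h + x0) - f x0 = df z * h by lra.
  rewrite mulrCA mulVf// mulr1; apply: Hd; rewrite /= /ball_/=.
  by move: hd; rewrite !ltr_norml; lra.
Qed.

(** The power x^-j is included because differentiation of exp(-1/x) produces such powers: the family
    is closed under derivation up to linear combinations, so all members are proved smooth
    together. *)
Definition flat (j : nat) (x : R) : R :=
  if 0 < x then x^-1 ^+ j * expR (- x^-1) else 0.

Lemma flat_ge0 j x : 0 <= flat j x.
Proof.
rewrite /flat; case: ifP => // x0.
by rewrite mulr_ge0 ?expR_ge0// exprn_ge0// invr_ge0 ltW.
Qed.

(** One term of the exponential series suffices: e^y >= 1 + y^(j+1) / (j+1)! at y = 1/x. Since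
    [flat j h / h = flat j.+1 h] for h > 0, the bound also gives the derivative 0 at the origin. *)
Lemma flat_le j x : 0 < x -> flat j x <= (j.+1)`!%:R * x.
Proof.
move=> x0; rewrite /flat x0 expRN ler_pdivrMr ?expR_gt0//.
have xV0 : 0 <= x^-1 by rewrite invr_ge0 ltW.
apply: le_trans (_ : (j.+1)`!%:R * x * (1 + x^-1 ^+ j.+1 / (j.+1)`!%:R) <= _); last first.
  by rewrite ler_pM2l ?expR_ge1Dxn// mulr_gt0// ltr0n fact_gt0.
have -> : (j.+1)`!%:R * x * (1 + x^-1 ^+ j.+1 / (j.+1)`!%:R) =
   (j.+1)`!%:R * x + x^-1 ^+ j.
  have : (j.+1)`!%:R != 0 :> R by rewrite pnatr_eq0 -lt0n fact_gt0.
  rewrite exprS; move: (x^-1 ^+ j) (_`!%:R) => y F F0; field.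
  by rewrite F0 gt_eqF.
by rewrite lerDr mulr_ge0// ltW.
Qed.

Lemma is_derive_flat j x :
  is_derive x (1 : R) (flat j) (flat j.+2 x - j%:R * flat j.+1 x).
Proof.
have [x0|x0|->] := ltgtP x 0.
- rewrite /flat ltNge (ltW x0)/= mulr0 subr0.
  apply: (@near_eq_is_derive _ _ _ (cst 0 : R -> R)).
  by near=> y; rewrite ltNge ltW//=; near: y; exact: lt_nbhsl.
- rewrite {2 3}/flat x0.
  apply: (@near_eq_is_derive _ _ _ (fun y : R => y^-1 ^+ j * expR (- y^-1))).
    by near=> y; rewrite /flat ifT//; near: y; exact: lt_nbhsr.
  have dV : is_derive x (1 : R) (fun y : R => y^-1) (- x ^- 2).
    have := is_deriveV (f := id) (lt0r_neq0 x0) (is_derive_id x (1 : R)).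
    by rewrite /= [_ *: _]mulr1.
  have dE : is_derive x (1 : R) (fun y : R => expR (- y^-1)) (expR (- x^-1) * x ^- 2).
    have h1 : is_derive x (1 : R) (fun y : R => - y^-1) (x ^- 2).
      by rewrite -[x ^- 2]opprK; exact: is_deriveN.
    exact: (is_derive1_comp (is_derive_expR _) h1).
  rewrite (_ : (fun y : R => _) = ((fun y : R => y^-1) ^+ j) *
                                  (fun y : R => expR (- y^-1))); last first.
    by apply/funext => y; rewrite !fctE.
  apply: is_derive_eq.
  rewrite /GRing.scale/= !fctE /=.
  rewrite -!exprVn; move: (expR (- x^-1)) => E; move: (x^-1) => y.
  case: j => [|j] /=; first by ring.
  by rewrite (exprS y j.+2) (exprS y j.+1) (exprS y j); ring.
- rewrite {2 3}/flat ltxx mulr0 subr0; apply: is_derive_eps => e e0.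
  have f0 : 0 < (j.+2)`!%:R :> R by rewrite ltr0n fact_gt0.
  exists (e / (j.+2)`!%:R); first by rewrite divr_gt0.
  move=> h h0 hd; rewrite addr0 {2}/flat ltxx subr0 sub0r normrN.
  have [hp|hn|/eqP] := ltgtP h 0; last by rewrite (negbTE h0).
    by rewrite /flat (lt_gtF hp) mulr0 normr0 ltW.
  have -> : h^-1 * flat j h = flat j.+1 h.
    by rewrite /flat hn exprS mulrA.
  rewrite ger0_norm ?flat_ge0//; apply: le_trans (flat_le _ hn) _.
  move: hd; rewrite gtr0_norm// ltr_pdivlMr// => hd.
  by rewrite mulrC ltW.
Unshelve. all: by end_near. Qed.

Lemma smooth_flat j : smooth (flat j).
Proof.
move=> n; elim: n j => // n IH j; split=> [x|v].
  by apply/derivable1_diffP; case: (is_derive_flat j x).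
rewrite (_ : 'D_v _ = fun x => cst v x * (flat j.+2 x + cst (- j%:R) x * flat j.+1 x)).
  apply: diff_classM; first exact: diff_class_cst.
  apply: diff_classD; first exact: IH.
  by apply: diff_classM; [exact: diff_class_cst|exact: IH].
apply/funext => x; have [d e] := is_derive_flat j x.
by rewrite deriveE_scale// derive1E e mulNr.
Qed.

Lemma flat_gt0 j x : (0 < flat j x) = (0 < x).
Proof.
rewrite /flat; have [x0|] := ltP 0 x; last by rewrite ltxx.
by rewrite mulr_gt0 ?expR_gt0// exprn_gt0// invr_gt0.
Qed.

Lemma flat_eq0 j x : x <= 0 -> flat j x = 0.
Proof. by move=> x0; rewrite /flat ltNge x0. Qed.

Let den x := flat 0 x + flat 0 (1 - x).

Let den_gt0 x : 0 < den x.
Proof.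
have [x0|x0] := ltP 0 x.
  by apply: ltr_wpDr; rewrite ?flat_ge0 ?flat_gt0.
by apply: ltr_wpDl; rewrite ?flat_ge0 ?flat_gt0//; lra.
Qed.

Definition step x := flat 0 x / (flat 0 x + flat 0 (1 - x)).

(** The quotient rule for [step], with [flat 2] as the derivative of [flat 0], simplified to a
    quotient of nonnegative terms so that its sign is visible. *)
Definition dstep x :=
  (flat 2 x * flat 0 (1 - x) + flat 0 x * flat 2 (1 - x)) /
  (flat 0 x + flat 0 (1 - x)) ^+ 2.

Lemma step0 x : x <= 0 -> step x = 0.
Proof. by move=> x0; rewrite /step flat_eq0// mul0r. Qed.

Lemma step1 x : 1 <= x -> step x = 1.
Proof.
move=> x1; have := den_gt0 x; rewrite /step /den (@flat_eq0 0 (1 - x)); last lra.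
by rewrite addr0 => f0; rewrite divff// gt_eqF.
Qed.

Lemma dstep0 x : x <= 0 \/ 1 <= x -> dstep x = 0.
Proof.
case=> hx; rewrite /dstep; first by rewrite !(@flat_eq0 _ x)// !mul0r add0r mul0r.
by rewrite !(@flat_eq0 _ (1 - x)) ?mulr0 ?addr0 ?mul0r//; lra.
Qed.

Lemma dstep_gt0 x : 0 < x < 1 -> 0 < dstep x.
Proof.
move=> /andP[x0 x1]; rewrite divr_gt0 ?exprn_gt0 ?den_gt0// addr_gt0//.
  by rewrite mulr_gt0 ?flat_gt0//; lra.
by rewrite mulr_gt0 ?flat_gt0//; lra.
Qed.

Lemma dstep_ge0 x : 0 <= dstep x.
Proof.
by rewrite divr_ge0// ?exprn_ge0 ?(ltW (den_gt0 _))// addr_ge0// mulr_ge0// flat_ge0.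
Qed.

Let smooth_flat1 j : smooth (fun x : R => flat j (1 - x)).
Proof.
apply: smooth_comp; first exact: smooth_flat.
by apply: smoothB; [exact: smooth_cst|exact: smooth_id].
Qed.

Lemma smooth_step : smooth step.
Proof.
apply: smoothM; first exact: smooth_flat.
apply: smoothV => [x|]; first by rewrite gt_eqF// den_gt0.
by apply: smoothD => //; exact: smooth_flat.
Qed.

Lemma is_derive_step x : is_derive x (1 : R) step (dstep x).
Proof.
have d0 y : is_derive y (1 : R) (flat 0) (flat 2 y).
  by have := is_derive_flat 0 y; rewrite mul0r subr0.
have ds : is_derive x (1 : R) (fun y : R => 1 - y) (- 1).
  by have := is_deriveB (is_derive_cst (1 : R) x (1 : R)) (is_derive_id x (1 : R));
     rewrite sub0r.
have d1 : is_derive x (1 : R) (fun y : R => flat 0 (1 - y)) (flat 2 (1 - x) * (- 1)).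
  exact: (is_derive1_comp (d0 _) ds).
have dd : is_derive x (1 : R) (fun y => (den y)^-1)
    (- (den x) ^- 2 *: (flat 2 x + flat 2 (1 - x) * (- 1))).
  apply: is_deriveV; first by rewrite gt_eqF// den_gt0.
have := is_deriveM (d0 x) dd.
rewrite (_ : flat 0 * _ = step); last by apply/funext => y.
move=> h; apply: (is_derive_eq h).
rewrite /dstep -/(den x) /GRing.scale/=.
have := den_gt0 x; rewrite /den => D0; field.
by rewrite gt_eqF.
Qed.

Definition bump x := step (2 - 2 * x) * step (2 + 2 * x).

Lemma smooth_bump : smooth bump.
Proof.
have s2 : smooth (fun x : R => 2 * x).
  by apply: smoothM; [exact: smooth_cst|exact: smooth_id].
apply: smoothM; apply: smooth_comp; try exact: smooth_step.
  by apply: smoothB => //; exact: smooth_cst.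
by apply: smoothD => //; exact: smooth_cst.
Qed.

Lemma bump1 x : `|x| <= 2^-1 -> bump x = 1.
Proof.
by rewrite ler_norml => /andP[x1 x2]; rewrite /bump !step1 ?mulr1//; lra.
Qed.

Lemma bump0 x : 1 <= `|x| -> bump x = 0.
Proof.
rewrite ler_normr /bump => /orP[x1|x1].
  by rewrite step0 ?mul0r//; lra.
by rewrite [X in _ * X]step0 ?mulr0//; lra.
Qed.

Lemma near_eq_derive1n (f g : R -> R) k (x : R) :
  (\forall y \near x, f y = g y) ->
  \forall y \near x, f^`(k)%classic y = g^`(k)%classic y.
Proof.
elim: k => //= k IH fg; have /near_join := IH fg.
apply: filterS => y yfg; rewrite !derive1E.
exact: near_eq_derive.
Qed.

Lemma derive1n_near0 (f : R -> R) k (x : R) :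
  (\forall y \near x, f y = 0) -> f^`(k)%classic x = 0.
Proof.
move=> /(@near_eq_derive1n f (cst 0) k)/nbhs_singleton ->.
by case: k => // k; elim: k x => [|k IH] x; rewrite derive1nS ?derive1_cst//;
   rewrite (_ : _^`(k.+1)%classic = cst 0) ?derive1_cst//; apply/funext.
Qed.

(** On [-1, 1] each derivative attains a maximum; outside, [f] vanishes near the point and so do its
    derivatives. *)
Lemma derive1n_bounded (f : R -> R) n : smooth f ->
  (forall x, 1 <= `|x| -> f x = 0) ->
  exists2 M, 0 < M & forall k x, (k <= n)%N -> `|f^`(k)%classic x| <= M.
Proof.
move=> sf f0.
have bd k : exists2 M, 0 < M & forall x, `|f^`(k)%classic x| <= M.
  have c : {within `[(-1 : R), 1], continuous (fun x => `|f^`(k)%classic x|)}.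
    apply: continuous_subspaceT => x.
    apply: (cvg_comp f^`(k)%classic Num.norm _ (@norm_continuous _ R _)).
    exact/smooth_continuous/smooth_derive1n.
  have [|z z1 zM] := EVT_max _ c; first lra.
  exists (`|f^`(k)%classic z| + 1); first by apply: ltr_wpDl.
  move=> x; apply: (@le_trans _ _ `|f^`(k)%classic z|); last by rewrite lerDl.
  have [x1|x1] := leP `|x| 1; first by apply: zM; rewrite in_itv/= -ler_norml.
  rewrite derive1n_near0 ?normr0//.
  apply: filterS (cvgr_gt _ (@norm_continuous _ R x) _ x1) => y y1.
  by apply: f0; exact: ltW.
elim: n => [|n [M M0 MP]].
  have [M M0 MP] := bd 0%N.
  by exists M => // k x; rewrite leqn0 => /eqP ->.
have [M' M'0 MP'] := bd n.+1.
exists (M + M'); first exact: addr_gt0.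
move=> k x; rewrite leq_eqVlt => /orP[/eqP ->|kn].
  by apply: le_trans (MP' x) _; rewrite lerDr ltW.
by apply: le_trans (MP k x kn) _; rewrite lerDl ltW.
Qed.

Lemma derive1n_dilation (f : R -> R) c l k x : smooth f ->
  (fun y : R => c * f (l * y))^`(k)%classic x = c * l ^+ k * f^`(k)%classic (l * x).
Proof.
move=> sf; pose F k (y : R) : R := c * l ^+ k * f^`(k)%classic (l * y).
rewrite (_ : (fun y => _) = F 0%N); last by apply/funext => y; rewrite /F mulr1.
suff dF j (y : R) : is_derive y (1 : R) (F j) (F j.+1 y) by rewrite (derive1n_tower _ dF).
move: j y => {}k {}x.
have dl : is_derive x (1 : R) (fun y : R => l * y) l.
  by have := is_deriveZ l (is_derive_id x (1 : R)); rewrite [_ *: _]mulr1.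
have dc := is_derive1_comp (smooth_is_derive k (l * x) sf) dl.
have := is_deriveZ (c * l ^+ k) dc.
by move=> h; apply: (is_derive_eq h); rewrite /F exprSr -[LHS]/(_ * _); ring.
Qed.

Lemma smooth_monomial c n : smooth (fun x : R => c * x ^+ n).
Proof.
apply: smoothM; first exact: smooth_cst.
elim: n => [|n IH]; first exact: smooth_cst.
rewrite (_ : (fun _ => _) = fun x : R => x * x ^+ n).
  by apply: smoothM => //; exact: smooth_id.
by apply/funext => x; rewrite exprS.
Qed.

Lemma derive1n_monomial0 c n k :
  (fun x : R => c * x ^+ n)^`(k)%classic 0 = if k == n then c * n`!%:R else 0.
Proof.
pose F k (x : R) : R := c * (n ^_ k)%:R * x ^+ (n - k).
rewrite (_ : (fun x => _) = F 0%N); last first.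
  by apply/funext => y; rewrite /F ffactn0 mulr1 subn0.
suff dF j (y : R) : is_derive y (1 : R) (F j) (F j.+1 y).
  rewrite (derive1n_tower _ dF) /F; have [->|] := eqVneq k n; first by rewrite ffactnn subnn expr0 mulr1.
  rewrite neq_ltn => /orP[kn|kn].
    by rewrite expr0n subn_eq0 leqNgt kn/= mulr0.
  by rewrite ffact_small// mulr0 mul0r.
move: j y => {}k x.
have := is_deriveZ (c * (n ^_ k)%:R) (is_deriveX (n - k) (is_derive_id x (1 : R))).
rewrite (_ : _ \*: _ = F k); last by apply/funext => y; rewrite /F /= fctE.
move=> h; apply: (is_derive_eq h).
by rewrite /F ffactnSr natrM subnS -[LHS]/(_ * (_ * 1)); ring.
Qed.

Lemma mean_value_le (f : R -> R) M x :
  smooth f -> (forall y, `|f^`(1)%classic y| <= M) -> `|f x - f 0| <= M * `|x|.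
Proof.
move=> sf fM; have df y : is_derive y (1 : R) f (f^`(1)%classic y).
  exact: (smooth_is_derive 0 y sf).
have cf (a b : R) : {within `[a, b], continuous f}.
  exact/continuous_subspaceT/smooth_continuous.
have [x0|x0] := leP 0 x.
  have [z _ ->] := MVT_segment x0 (fun y _ => df y) (cf _ _).
  by rewrite subr0 normrM ler_wpM2r.
have [z _ E] := MVT_segment (ltW x0) (fun y _ => df y) (cf _ _).
by rewrite distrC E sub0r normrM normrN ler_wpM2r.
Qed.

(* A rescaled cut-off of the monomial a x^n / n!. *)
Lemma borel_term a n : exists T : R -> R,
  [/\ smooth T,
      forall k, T^`(k)%classic 0 = if k == n then a else 0,
      forall k x, n.+1%:R^-1 < `|x| -> T^`(k)%classic x = 0 &
      forall k x, (k.+2 <= n)%N -> `|T^`(k)%classic x| <= 2^-1 ^+ n * `|x|].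
Proof.
pose g (x : R) : R := 1 * x ^+ n * bump x.
have sg : smooth g by apply: smoothM; [exact: smooth_monomial|exact: smooth_bump].
have g0 x : 1 <= `|x| -> g x = 0 by move=> x1; rewrite /g bump0 ?mulr0.
have [M M0 gM] := derive1n_bounded n sg g0.
have N0 : 0 < n`!%:R :> R by rewrite ltr0n fact_gt0.
have N1 : 1 <= n`!%:R :> R by rewrite ler1n fact_gt0.
have n1 : 0 < n.+1%:R :> R by rewrite ltr0n.
(* The first bound shrinks the support to |x| <= 1/(n+1). The second makes derivatives of order k <
   n small: they are at most |a| l^(n-k) M <= l |a| M <= 2^-n. The summand 1 keeps the divisor
   positive when a = 0. *)
pose l := Num.min (n.+1%:R^-1) (2^-1 ^+ n / ((`|a| + 1) * M)).
have aM0 : 0 < (`|a| + 1) * M by rewrite mulr_gt0// ltr_wpDl.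
have h2 : 0 < 2^-1 ^+ n :> R by rewrite exprn_gt0// invr_gt0.
have l0 : 0 < l by rewrite lt_min invr_gt0 n1 divr_gt0.
have ln : l <= n.+1%:R^-1 by rewrite ge_min lexx.
have l1 : l <= 1 by apply: le_trans ln _; rewrite invf_le1// ler1n.
have lM : l * (`|a| * M) <= 2^-1 ^+ n.
  have : l <= 2^-1 ^+ n / ((`|a| + 1) * M) by rewrite ge_min lexx orbT.
  rewrite ler_pdivlMr//; apply: le_trans; rewrite ler_pM2l// ler_pM2r//.
  by rewrite lerDl.
pose c := a / n`!%:R * l ^+ n.
pose T (x : R) : R := c * g (l^-1 * x).
have TE k x : T^`(k)%classic x = c * l^-1 ^+ k * g^`(k)%classic (l^-1 * x).
  by rewrite [LHS]derive1n_dilation.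
have sT : smooth T.
  apply: smoothM; first exact: smooth_cst.
  apply: smooth_comp => //.
  by apply: smoothM; [exact: smooth_cst|exact: smooth_id].
have T0 k : T^`(k)%classic 0 = if k == n then a else 0.
  rewrite TE mulr0.
  have -> : g^`(k)%classic 0 = (fun x : R => 1 * x ^+ n)^`(k)%classic 0.
    have gm : \forall y \near (0 : R), g y = 1 * y ^+ n.
      apply: filterS (nbhs0_le (e := 2^-1) _) => [y y2|]; last by rewrite invr_gt0.
      by rewrite /g bump1 ?mulr1.
    exact: (nbhs_singleton (near_eq_derive1n k gm)).
  rewrite derive1n_monomial0; case: eqP => [->|_]; last by rewrite mulr0.
  have ll : l ^+ n * l^-1 ^+ n = 1 by rewrite -exprMn divff ?expr1n// gt_eqF.
  by rewrite mul1r /c -(mulrA _ (l ^+ n)) ll mulr1 divfK// gt_eqF.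
have Tb k x : (k.+1 <= n)%N -> `|T^`(k)%classic x| <= 2^-1 ^+ n.
  move=> kn; rewrite TE normrM; apply: le_trans lM.
  have cl : `|c * l^-1 ^+ k| <= l * `|a|.
    have le : l ^+ n = l ^+ (n - k) * l ^+ k by rewrite -exprD subnK// ltnW.
    rewrite /c -mulrA normrM le -mulrA -exprMn divff ?gt_eqF//.
    rewrite expr1n mulr1 normrM normfV (gtr0_norm N0).
    rewrite mulrC ler_pM ?normr_ge0//.
      rewrite normrX gtr0_norm//.
      have -> : (n - k = (n - k).-1.+1)%N by rewrite prednK// subn_gt0.
      by rewrite exprS ger_pMr// exprn_ile1// ltW.
    by rewrite ler_pdivrMr// ler_peMr.
  rewrite mulrA ler_pM//; apply: gM; exact: ltnW.
exists T; split=> // [k x nx|k x kn].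
  apply: derive1n_near0.
  apply: filterS (cvgr_gt _ (@norm_continuous _ R x) _ nx) => y y1.
  rewrite /T g0 ?mulr0// normrM gtr0_norm ?invr_gt0// mulrC ler_pdivlMr// mul1r.
  by apply: le_trans ln _; exact: ltW.
(* The factor |x| comes from the mean value theorem, at the price of bounding the derivative of
   order k + 1; hence the condition k + 2 <= n. *)
have -> : T^`(k)%classic x = T^`(k)%classic x - T^`(k)%classic 0.
  by rewrite T0 ltn_eqF ?subr0// (leq_trans _ kn).
apply: mean_value_le; first exact: smooth_derive1n.
by move=> y; exact: (Tb k.+1).
Unshelve. all: by end_near. Qed.

Lemma sum_half_le M m : \sum_(m <= n < M) 2^-1 ^+ n <= 2 :> R.
Proof.
apply: (@le_trans _ _ (\sum_(0 <= n < M) 2^-1 ^+ n)).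
  have [mM|Mm] := leqP m M; last first.
    by rewrite big_geq ?(ltnW Mm)//; apply: sumr_ge0 => i _; rewrite exprn_ge0// invr_ge0.
  rewrite (big_cat_nat (leq0n m) mM)//= lerDr; apply: sumr_ge0 => i _.
  by rewrite exprn_ge0// invr_ge0.
suff -> : \sum_(0 <= n < M) 2^-1 ^+ n = 2 - 2 * 2^-1 ^+ M :> R.
  by rewrite gerBl mulr_ge0// exprn_ge0// invr_ge0.
elim: M => [|M IH]; first by rewrite big_geq// expr0 mulr1 subrr.
by rewrite big_nat_recr//= IH exprS; field.
Qed.

(* Away from 0 only finitely many of the terms [T n] are nonzero; at 0 the k-th
   derivative of the sum stays within 2 |x| of that of its first k + 2 terms. *)
Theorem borel (a : nat -> R) :
  exists f : R -> R, smooth f /\ forall k, f^`(k)%classic 0 = a k.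
Proof.
have /choice[T HT] : forall n, exists T : R -> R,
  [/\ smooth T,
      forall k, T^`(k)%classic 0 = if k == n then a n else 0,
      forall k x, n.+1%:R^-1 < `|x| -> T^`(k)%classic x = 0 &
      forall k x, (k.+2 <= n)%N -> `|T^`(k)%classic x| <= 2^-1 ^+ n * `|x|].
  by move=> n; exact: borel_term.
have sT n : smooth (T n) by case: (HT n).
pose S M k (x : R) : R := \sum_(0 <= n < M) (T n)^`(k)%classic x.
have sS M k : smooth (S M k).
  by apply: smooth_sum => n; exact: smooth_derive1n.
have dS M k x : is_derive x (1 : R) (S M k) (S M k.+1 x).
  apply: DeriveDef; first exact: smooth_derivable.
  elim: M => [|M IH].
    rewrite /S (_ : (fun _ => _) = cst 0) ?derive_cst ?big_geq//.
    by apply/funext => y; rewrite big_geq.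
  rewrite (_ : S M.+1 k = fun y => S M k y + (T M)^`(k)%classic y); last first.
    by apply/funext => y; rewrite /S big_nat_recr.
  rewrite deriveD; [|exact: smooth_derivable|exact/smooth_derivable/smooth_derive1n].
  by rewrite IH -derive1E -derive1nS [RHS]big_nat_recr.
pose N (x : R) := (Num.truncn `|x|^-1).+1.
have SN M k x : x != 0 -> (N x <= M)%N -> S M k x = S (N x) k x.
  move=> x0 NM; rewrite /S (big_cat_nat (leq0n _) NM)//=.
  rewrite -[RHS]addr0; congr (_ + _); rewrite big_nat; apply: big1 => n /andP[Nn _].
  case: (HT n) => _ _ H _; apply: H.
  have x0' : 0 < `|x| by rewrite normr_gt0.
  rewrite invf_plt ?posrE//; apply: (@lt_le_trans _ _ (N x)%:R).
    exact: truncnS_gt.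
  by rewrite ler_nat ltnW.
(* With the convention 0^-1 = 0 the cut-off [N 0] is 1 and would keep a single term, so the value at
   0 is prescribed. *)
pose F k x := if x == 0 then a k else S (N x) k x.
have F0 k : F k 0 = a k by rewrite /F eqxx.
have FS k x : x != 0 -> F k x = S (N x) k x by move=> x0; rewrite /F (negbTE x0).
have dF k x : x != 0 -> is_derive x (1 : R) (F k) (F k.+1 x).
  (* [M] bounds [N y] for all y with |y| > |x| / 2, so near x the function [F k] is the fixed finite
     sum [S M k]. *)
  move=> x0; pose M := (Num.truncn (`|x| / 2)^-1).+1.
  have xgt : 0 < `|x| by rewrite normr_gt0.
  have NM y : `|x| / 2 < `|y| -> (y != 0) * (N y <= M)%N.
    move=> xy; have y0 : 0 < `|y| by apply: lt_trans xy; rewrite divr_gt0.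
    split; first by rewrite -normr_gt0.
    by rewrite ltnS le_truncn// lef_pV2 ?posrE ?divr_gt0// ltW.
  have x2 : `|x| / 2 < `|x| by lra.
  have [_ NxM] := NM x x2.
  rewrite FS// -(SN M)//.
  apply: near_eq_is_derive (dS M k x).
  apply: filterS (cvgr_gt _ (@norm_continuous _ R x) _ x2) => y /NM[y0 NyM].
  by rewrite FS// -(SN M).
have S0 k : S k.+2 k 0 = a k.
  rewrite /S big_mkord (bigD1 (Ordinal (leqnSn k.+1)))//= big1 => [|[n nk] /=].
    by rewrite addr0; case: (HT k) => _ -> _ _; rewrite eqxx.
  rewrite -val_eqE/= => nek; case: (HT n) => _ -> _ _.
  by rewrite eq_sym (negbTE nek).
have cF k : {for 0, continuous (F k)}.
  have SF x : x != 0 -> `|F k x - S k.+2 k x| <= 2 * `|x|.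
    move=> x0; rewrite FS// -(SN (maxn k.+2 (N x)))// ?leq_maxr//.
    rewrite /S (big_cat_nat (leq0n _) (leq_maxl k.+2 (N x)))//= addrAC subrr add0r.
    apply: le_trans (ler_norm_sum _ _ _) _.
    apply: (@le_trans _ _ (\sum_(k.+2 <= n < maxn k.+2 (N x)) 2^-1 ^+ n * `|x|)).
      apply: ler_sum_nat => n /andP[kn _].
      by case: (HT n) => _ _ _; apply.
    by rewrite -mulr_suml ler_wpM2r// sum_half_le.
  apply/cvgrPdist_le => /= e e0; rewrite F0.
  have e2 : 0 < e / 2 by rewrite divr_gt0.
  have e4 : 0 < e / 4 by rewrite divr_gt0.
  have /cvgrPdist_le/(_ _ e2) := smooth_continuous (sS k.+2 k) (x := 0).
  move=> h1; have h2 := nbhs0_le (V := R) e4.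
  apply: filterS2 h1 h2 => y; rewrite S0 => h1 h2.
  have [->|y0] := eqVneq y 0; first by rewrite F0 subrr normr0 ltW.
  have h3 := SF y y0.
  rewrite -(subrK (S k.+2 k y) (a k)) -addrA (le_trans (ler_normD _ _))//.
  rewrite [X in _ + X]distrC; lra.
have dF' k x : is_derive x (1 : R) (F k) (F k.+1 x).
  have [->|x0] := eqVneq x 0; last exact: dF.
  by apply: is_derive_of_cvg => // y; exact: dF.
exists (F 0%N); split; first exact: smooth_tower.
by move=> k; rewrite (derive1n_tower _ dF') F0.
Qed.

Lemma derive1n_shift (f : R -> R) b k x : smooth f ->
  (fun y : R => f (y - b))^`(k)%classic x = f^`(k)%classic (x - b).
Proof.
move=> sf; pose F k (y : R) : R := f^`(k)%classic (y - b).
suff dF j (y : R) : is_derive y (1 : R) (F j) (F j.+1 y).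
  by rewrite -[LHS]/((F 0%N)^`(k)%classic x) (derive1n_tower _ dF).
have ds : is_derive y (1 : R) (fun y : R => y - b) 1.
  by have := is_deriveB (is_derive_id y (1 : R)) (is_derive_cst b y (1 : R)); rewrite subr0.
have := @is_derive1_comp _ _ (fun y : R => y - b) _ _ _ (smooth_is_derive j (y - b) sf) ds.
by rewrite mulr1.
Qed.

End FlatAndBorel.

(** * Closing timelike paths in coordinates *)

Section Closing.
Context {R : realType}.
Implicit Types f g : R -> R.

Lemma derive1_smoothD f g x : smooth f -> smooth g ->
  derive1 (fun y => f y + g y) x = derive1 f x + derive1 g x.
Proof.
by move=> sf sg; rewrite !derive1E; apply: deriveD; exact: smooth_derivable.
Qed.

Lemma derive1_smoothM f g x : smooth f -> smooth g ->
  derive1 (fun y => f y * g y) x = derive1 f x * g x + f x * derive1 g x.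
Proof.
move=> sf sg; rewrite !derive1E deriveM; [|exact: smooth_derivable..].
by rewrite addrC [X in X + _]mulrC.
Qed.

Lemma derive1_smoothN f x : smooth f -> derive1 (fun y => - f y) x = - derive1 f x.
Proof. by move=> sf; rewrite !derive1E; apply: deriveN; exact: smooth_derivable. Qed.

Lemma derive1_smoothB f g x : smooth f -> smooth g ->
  derive1 (fun y => f y - g y) x = derive1 f x - derive1 g x.
Proof.
by move=> sf sg; rewrite derive1_smoothD ?derive1_smoothN//; exact: smoothN.
Qed.

Lemma derive1_smoothZ k f x : smooth f -> derive1 (fun y => k * f y) x = k * derive1 f x.
Proof.
move=> sf; rewrite (derive1_smoothM (f := cst k))//; last exact: smooth_cst.
by rewrite derive1_cst mul0r add0r.
Qed.

Lemma smooth_derive1 f : smooth f -> smooth (derive1 f).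
Proof. exact: (smooth_derive1n 1). Qed.

Definition ramp (a l x : R) : R := step (l * (x - a)).

Lemma smooth_ramp a l : smooth (ramp a l).
Proof.
apply: smooth_comp; first exact: smooth_step.
by apply: smoothZ; apply: smoothB; [exact: smooth_id|exact: smooth_cst].
Qed.

Lemma derive1_ramp a l x : derive1 (ramp a l) x = l * dstep (l * (x - a)).
Proof.
have dl : is_derive x (1 : R) (fun y : R => l * (y - a)) l.
  have := is_deriveZ l (is_deriveB (is_derive_id x (1 : R)) (is_derive_cst a x (1 : R))).
  by rewrite subr0 [_ *: _]mulr1.
have := @is_derive1_comp _ _ (fun y : R => l * (y - a)) _ _ _ (is_derive_step _) dl.
by rewrite derive1E mulrC => -[_ <-].
Qed.

(** The quantity u along a path. Together with [speed2] it expresses timelikeness, as in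
    [timelike_g3P]; the sign of [slope] is the time direction. *)
Definition slope (f0 f1 f2 : R -> R) (x : R) : R := derive1 f0 x + f2 x * derive1 f1 x.

Definition speed2 (f1 f2 : R -> R) (x : R) : R := derive1 f1 x ^+ 2 + derive1 f2 x ^+ 2.

Lemma smooth_slope f0 f1 f2 :
  smooth f0 -> smooth f1 -> smooth f2 -> smooth (slope f0 f1 f2).
Proof.
move=> s0 s1 s2; apply: smoothD; first exact: smooth_derive1.
by apply: smoothM => //; exact: smooth_derive1.
Qed.

Lemma smooth_speed2 f1 f2 : smooth f1 -> smooth f2 -> smooth (speed2 f1 f2).
Proof.
by move=> s1 s2; apply: smoothD; apply: smoothM; exact: smooth_derive1.
Qed.

Lemma timelike_nbhs (C s : R) (f0 f1 f2 : R -> R) :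
  smooth f0 -> smooth f1 -> smooth f2 ->
  speed2 f1 f2 0 < C * slope f0 f1 f2 0 ^+ 2 -> 0 < s * slope f0 f1 f2 0 ->
  exists2 d, 0 < d & forall x, `|x| <= d ->
    speed2 f1 f2 x < C * slope f0 f1 f2 x ^+ 2 /\ 0 < s * slope f0 f1 f2 x.
Proof.
move=> s0 s1 s2 h1 h2.
have sU := smooth_slope s0 s1 s2; have sV := smooth_speed2 s1 s2.
have sW : smooth (fun x => C * slope f0 f1 f2 x ^+ 2 - speed2 f1 f2 x).
  by apply: smoothB => //; apply: smoothZ; exact: smoothM.
have c1 : {for 0, continuous (fun x => C * slope f0 f1 f2 x ^+ 2 - speed2 f1 f2 x)}.
  exact: smooth_continuous.
have c2 : {for 0, continuous (fun x => s * slope f0 f1 f2 x)}.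
  exact: (smooth_continuous (smoothZ s sU)).
rewrite -subr_gt0 in h1.
have [d1 /= d10 n1] := cvgr_gt _ c1 _ h1.
have [d2 /= d20 n2] := cvgr_gt _ c2 _ h2.
exists (Num.min d1 d2 / 2); first by rewrite divr_gt0// lt_min d10.
move=> x xd; have xm : `|x| < Num.min d1 d2.
  by apply: le_lt_trans xd _; rewrite ltr_pdivrMr// ltr_pMr ?ltr1n// lt_min d10.
move: xm; rewrite lt_min => /andP[x1 x2].
split.
  by rewrite -subr_gt0; apply: n1; rewrite /ball_/= sub0r normrN.
by apply: n2; rewrite /ball_/= sub0r normrN.
Qed.

Lemma bounded_on f a b : a <= b -> smooth f ->
  exists2 M, 0 <= M & forall x, a <= x <= b -> `|f x| <= M.
Proof.
move=> ab sf.
have c : {within `[a, b], continuous (fun x => `|f x|)}.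
  apply: continuous_subspaceT => x.
  apply: (cvg_comp f Num.norm _ (@norm_continuous _ R _)).
  exact: (@smooth_continuous _ _ f sf x).
have [z _ zM] := EVT_max ab c.
by exists `|f z| => // x xab; apply: zM; rewrite in_itv.
Qed.

(** The hypothesis collects every cross term of the blended path h, the loop (s r k1, r k2) and its
    compensation - s r^2 e4; what remains is the slope of h plus the drift. *)
Lemma slope_algebra (dh0 dh1 h2 k2 dk1 de4 deta s r : R) :
  - (s * r ^+ 2 * de4) + s * r * h2 * dk1 + r * k2 * dh1 + s * r ^+ 2 * (k2 * dk1) = 0 ->
  dh0 + s * r ^+ 2 * (deta - de4) + (h2 + r * k2) * (dh1 + s * r * dk1) =
  dh0 + h2 * dh1 + s * r ^+ 2 * deta.
Proof. by move=> E; rewrite -[RHS]addr0 -E; ring. Qed.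

(** Each planar velocity component is at most 2 M r, so the planar speed is below 4 M r, while c
    |slope| is at least c (m r^2 - M). Here s = 1 or s = -1 is the time direction. *)
Lemma drift_dominates (c m M : R) : 0 < c -> 0 < m -> 0 <= M ->
  exists2 r, 1 <= r & forall s a1 b1 a2 b2 u w, s * s = 1 ->
    `|a1| <= M -> `|b1| <= M -> `|a2| <= M -> `|b2| <= M -> `|u| <= M -> m <= w ->
    (a1 + s * r * b1) ^+ 2 + (a2 + r * b2) ^+ 2 < c ^+ 2 * (u + s * r ^+ 2 * w) ^+ 2.
Proof.
(* This solves c m r = c m + c M + 4 M, whence c (m r^2 - M) = c m r + 4 M r + c M (r - 1) > 4 M r.
   The positive term c m r keeps the inequality strict even for M = 0. *)
move=> c0 m0 M0; pose r := 1 + (c * M + 4 * M) / (c * m).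
have cm0 : 0 < c * m by rewrite mulr_gt0.
have r1 : 1 <= r by rewrite lerDl divr_ge0 ?addr_ge0 ?mulr_ge0// ltW.
have rE : c * m * r = c * m + c * M + 4 * M.
  by rewrite /r mulrDr mulr1 mulrCA divff ?gt_eqF// mulr1 addrA.
exists r => //; move: r r1 rE => r r1 rE s a1 b1 a2 b2 u w s1.
have r0 : 0 <= r by apply: le_trans r1.
have ns : `|s| = 1 by apply/eqP; rewrite -sqrp_eq1// -normrX expr2 s1 normr1.
have bound (a b : R) : `|a| <= M -> `|b| <= M -> `|a + r * b| <= 2 * M * r.
  move=> aM bM; apply: le_trans (ler_normD _ _) _; rewrite normrM (ger0_norm r0).
  have h1 : r * `|b| <= r * M by rewrite ler_wpM2l.
  have h2 : M <= M * r by rewrite ler_peMr.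
  by lra.
have sqle (t : R) : `|t| <= 2 * M * r -> t ^+ 2 <= (2 * M * r) ^+ 2.
  move=> ht; rewrite -(real_normK (num_real t)) lerXn2r ?nnegrE//.
  exact: le_trans ht.
move=> h1 h2 h3 h4 h5 h6.
have B1 : (a1 + s * r * b1) ^+ 2 <= (2 * M * r) ^+ 2.
  apply: sqle; rewrite (mulrC s) -[r * s * b1]mulrA; apply: bound => //.
  by rewrite normrM ns mul1r.
have B2 := sqle _ (bound _ _ h3 h4).
have hu : - M <= s * u.
  have : `|s * u| <= M by rewrite normrM ns mul1r.
  by rewrite ler_norml => /andP[].
have -> : c ^+ 2 * (u + s * r ^+ 2 * w) ^+ 2 = (c * (s * u + r ^+ 2 * w)) ^+ 2.
  transitivity (s * s * (c ^+ 2 * (u + s * r ^+ 2 * w) ^+ 2)); first by rewrite s1 mul1r.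
  transitivity ((c * (s * u + s * s * (r ^+ 2 * w))) ^+ 2); first by ring.
  by rewrite s1 mul1r.
have b0 : 4 * M * r < c * (s * u + r ^+ 2 * w).
  apply: lt_le_trans (_ : c * (- M + r ^+ 2 * m) <= _); last first.
    rewrite ler_pM2l//; apply: lerD => //.
    by rewrite ler_wpM2l// sqr_ge0.
  have -> : c * (- M + r ^+ 2 * m) = c * m * r * r - c * M by ring.
  rewrite rE; have h7 : c * M <= c * M * r by rewrite ler_peMr// mulr_ge0// ltW.
  have h8 : 0 < c * m * r by rewrite mulr_gt0// (lt_le_trans _ r1).
  by rewrite !mulrDl; lra.
have B0 : 0 <= 2 * M * r by rewrite !mulr_ge0.
apply: le_lt_trans (lerD B1 B2) _.
apply: le_lt_trans (_ : (4 * M * r) ^+ 2 < _).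
  have -> : 4 * M * r = 2 * (2 * M * r) by ring.
  by rewrite [leRHS]exprMn; have := sqr_ge0 (2 * M * r); lra.
by rewrite ltrXn2r ?nnegrE//; lra.
Qed.

(** * A timelike transition between two given end pieces *)

Section Connecting.
Variables (c sg : R) (p0 p1 p2 q0 q1 q2 : R -> R) (d : R).
Hypotheses (c0 : 0 < c) (sg1 : sg * sg = 1) (d0 : 0 < d).
Hypotheses (sp0 : smooth p0) (sp1 : smooth p1) (sp2 : smooth p2).
Hypotheses (sq0 : smooth q0) (sq1 : smooth q1) (sq2 : smooth q2).
Hypothesis ptl : forall x, 0 <= x <= 2 * d ->
  speed2 p1 p2 x < c ^+ 2 * slope p0 p1 p2 x ^+ 2 /\ 0 < sg * slope p0 p1 p2 x.
Hypothesis qtl : forall x, 8 * d <= x <= 10 * d ->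
  speed2 q1 q2 x < c ^+ 2 * slope q0 q1 q2 x ^+ 2 /\ 0 < sg * slope q0 q1 q2 x.

(** Timetable on [0, 10 d]: [e j] rises from 0 to 1 on [j d, (j+1) d]. The piece p is switched off
    in slot 2, the loop occupies slots 3 to 6, and q is switched on in slot 7. The drift [eta] rises
    on the longer interval [d, 9 d], so that its derivative is positive on all of [2 d, 8 d]. *)
Let e (j : nat) : R -> R := ramp (j%:R * d) d^-1.
Let eta : R -> R := ramp d (8 * d)^-1.

Let se j : smooth (e j). Proof. exact: smooth_ramp. Qed.
Let seta : smooth eta. Proof. exact: smooth_ramp. Qed.

Let e_lo j x : x <= j%:R * d -> e j x = 0.
Proof.
by move=> h; apply: step0; rewrite mulrC ler_pdivrMr// mul0r subr_le0.
Qed.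

Let e_hi j x : j.+1%:R * d <= x -> e j x = 1.
Proof.
by move=> h; apply: step1; rewrite mulrC ler_pdivlMr// mul1r; move: h; rewrite mulrSr; lra.
Qed.

Let de_out j x : x <= j%:R * d \/ j.+1%:R * d <= x -> derive1 (e j) x = 0.
Proof.
move=> h; rewrite derive1_ramp dstep0 ?mulr0//.
case: h => h; [left|right].
  by rewrite mulrC ler_pdivrMr// mul0r subr_le0.
by rewrite mulrC ler_pdivlMr// mul1r; move: h; rewrite mulrSr; lra.
Qed.

Let eta_lo x : x <= d -> eta x = 0.
Proof. by move=> h; apply: step0; rewrite mulrC ler_pdivrMr ?mulr_gt0// mul0r subr_le0. Qed.

Let eta_hi x : 9 * d <= x -> eta x = 1.
Proof.
by move=> h; apply: step1; rewrite mulrC ler_pdivlMr ?mulr_gt0// mul1r; lra.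
Qed.

Let deta_ge0 x : 0 <= derive1 eta x.
Proof.
by rewrite derive1_ramp mulr_ge0 ?dstep_ge0// invr_ge0 mulr_ge0// ltW.
Qed.

Let deta_gt0 x : 2 * d <= x <= 8 * d -> 0 < derive1 eta x.
Proof.
move=> /andP[h1 h2]; have d8 : 0 < 8 * d by rewrite mulr_gt0.
rewrite derive1_ramp mulr_gt0 ?invr_gt0//; apply: dstep_gt0.
by rewrite mulrC ltr_pdivlMr// ltr_pdivrMr// mul0r mul1r; apply/andP; split; lra.
Qed.

Let H (p q : R -> R) x := (1 - e 2 x) * p x + e 7 x * q x.

Let sH p q : smooth p -> smooth q -> smooth (H p q).
Proof.
move=> sp sq; apply: smoothD; last exact: smoothM.
by apply: smoothM => //; apply: smoothB => //; exact: smooth_cst.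
Qed.

Let dH p q x : smooth p -> smooth q -> derive1 (H p q) x =
  - derive1 (e 2) x * p x + (1 - e 2 x) * derive1 p x +
  (derive1 (e 7) x * q x + e 7 x * derive1 q x).
Proof.
move=> sp sq.
have s1 : smooth (fun x => 1 - e 2 x) by apply: smoothB => //; exact: smooth_cst.
rewrite [LHS]derive1_smoothD; [|exact: smoothM|exact: smoothM].
rewrite (derive1_smoothM x s1 sp) (derive1_smoothM x (se 7) sq).
by rewrite (derive1_smoothB x (smooth_cst 1) (se 2)) derive1_cst sub0r.
Qed.

(** With [k2] this runs around a unit square, one side per slot: x2 up, x1 up, x2 down, x1 down.
    While x1 increases [k2] is 1, while it decreases [k2] is 0; thus k2 k1' is exactly the
    derivative of [e 4]. *)
Let k1 x := e 4 x - e 6 x.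
Let k2 x := e 3 x - e 5 x.
Let sk1 : smooth k1. Proof. exact: smoothB. Qed.
Let sk2 : smooth k2. Proof. exact: smoothB. Qed.
Let dk1 x : derive1 k1 x = derive1 (e 4) x - derive1 (e 6) x.
Proof. exact: derive1_smoothB. Qed.
Let dk2 x : derive1 k2 x = derive1 (e 3) x - derive1 (e 5) x.
Proof. exact: derive1_smoothB. Qed.

(** Both [eta] and [e 4] go from 0 to 1, so drift and compensation cancel at the end and q0 is
    reached exactly. The factor [sg] points the drift in the time direction of the end pieces; [z1]
    carries it as well, so that the area of the loop has the same sign. *)
Let z0 (r : R) x := H p0 q0 x + sg * r ^+ 2 * (eta x - e 4 x).
Let z1 (r : R) x := H p1 q1 x + sg * r * k1 x.
Let z2 (r : R) x := H p2 q2 x + r * k2 x.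

Let sz0 r : smooth (z0 r).
Proof. by apply: smoothD; [exact: sH|apply: smoothZ; exact: smoothB]. Qed.
Let sz1 r : smooth (z1 r).
Proof. by apply: smoothD; [exact: sH|exact: smoothZ]. Qed.
Let sz2 r : smooth (z2 r).
Proof. by apply: smoothD; [exact: sH|exact: smoothZ]. Qed.

Let dz0 r x : derive1 (z0 r) x =
  derive1 (H p0 q0) x + sg * r ^+ 2 * (derive1 eta x - derive1 (e 4) x).
Proof.
have s1 : smooth (fun x => eta x - e 4 x) by exact: smoothB.
rewrite [LHS]derive1_smoothD; [|exact: sH|exact: smoothZ].
by rewrite derive1_smoothZ// derive1_smoothB.
Qed.
Let dz1 r x : derive1 (z1 r) x = derive1 (H p1 q1) x + sg * r * derive1 k1 x.
Proof.
by rewrite [LHS]derive1_smoothD; [rewrite derive1_smoothZ|exact: sH|exact: smoothZ].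
Qed.
Let dz2 r x : derive1 (z2 r) x = derive1 (H p2 q2) x + r * derive1 k2 x.
Proof.
by rewrite [LHS]derive1_smoothD; [rewrite derive1_smoothZ|exact: sH|exact: smoothZ].
Qed.

(* The loop [k1, k2] encloses signed area 1, which the term [- e 4] of [z0]
   balances pointwise; only the drift along [eta] survives in the slope. *)
Let slope_z r x : slope (z0 r) (z1 r) (z2 r) x =
  slope (H p0 q0) (H p1 q1) (H p2 q2) x + sg * r ^+ 2 * derive1 eta x.
Proof.
rewrite /slope dz0 dz1 /z2; apply: slope_algebra.
have dp := d0; have [x3|x3] := leP x (3 * d).
  rewrite dk1 /k2 !(@de_out _ x) ?e_lo; try (left; lra); try lra.
have [x7|x7] := leP (7 * d) x.
  rewrite dk1 /k2 !(@de_out _ x) ?e_hi; try (right; lra); try lra.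
(* Between 3 d and 7 d p is already off and q still off, so the loop meets no cross terms with the
   blend. *)
have -> : H p2 q2 x = 0 by rewrite /H (e_lo (j := 7)) ?(e_hi (j := 2)); [ring|lra..].
have -> : derive1 (H p1 q1) x = 0.
  rewrite dH// (e_lo (j := 7)) ?(e_hi (j := 2)); try lra.
  by rewrite (@de_out 2) ?(@de_out 7); [ring|left; lra|right; lra].
suff -> : k2 x * derive1 k1 x = derive1 (e 4) x by ring.
rewrite dk1 /k2; have [x4|x4] := leP x (4 * d).
  by rewrite !(@de_out _ x); [ring|left; lra|left; lra].
have [x5|x5] := leP x (5 * d).
  rewrite (e_hi (j := 3)) ?(e_lo (j := 5)) ?(@de_out 6); [ring|left; lra|lra|lra].
have [x6|x6] := leP x (6 * d).
  by rewrite (@de_out 4) ?(@de_out 6); [ring|left; lra|right; lra].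
by rewrite (e_hi (j := 3)) ?(e_hi (j := 5)) ?(@de_out 4); [ring|right; lra|lra|lra].
Qed.

(** On [0, 2 d] and [8 d, 10 d] loop and blend leave the given timelike pieces alone and the drift
    only enlarges |slope|; on [2 d, 8 d] the drift rate has a positive minimum and a large r wins.
    Agreement with p and q is on whole neighbourhoods of the ends, so all jets are inherited. *)
Lemma connecting_loop :
  exists z0 z1 z2 : R -> R, [/\ [/\ smooth z0, smooth z1 & smooth z2],
    forall x, x <= d -> [/\ z0 x = p0 x, z1 x = p1 x & z2 x = p2 x],
    forall x, 9 * d <= x -> [/\ z0 x = q0 x, z1 x = q1 x & z2 x = q2 x] &
    forall x, 0 <= x <= 10 * d ->
      speed2 z1 z2 x < c ^+ 2 * slope z0 z1 z2 x ^+ 2].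
Proof.
have dp := d0; have d10 : 0 <= 10 * d by rewrite mulr_ge0// ltW.
have [M1 M10 hM1] := bounded_on d10 (smooth_derive1 (sH sp1 sq1)).
have [M2 M20 hM2] := bounded_on d10 (smooth_derive1 (sH sp2 sq2)).
have [M3 M30 hM3] := bounded_on d10 (smooth_derive1 sk1).
have [M4 M40 hM4] := bounded_on d10 (smooth_derive1 sk2).
have [M5 M50 hM5] := bounded_on d10 (smooth_slope (sH sp0 sq0) (sH sp1 sq1) (sH sp2 sq2)).
pose M := M1 + M2 + M3 + M4 + M5.
have [m m0 hm] : exists2 m, 0 < m & forall x, 2 * d <= x <= 8 * d -> m <= derive1 eta x.
  have [||y /[!in_itv]/= yin ym] := @EVT_min _ (derive1 eta) (2 * d) (8 * d).
  - by lra.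
  - exact/continuous_subspaceT/smooth_continuous/smooth_derive1.
  exists (derive1 eta y); first exact: deta_gt0.
  by move=> x hx; apply: ym; rewrite in_itv.
have M0 : 0 <= M by rewrite /M !addr_ge0.
have [r _ hr] := drift_dominates c0 m0 M0.
exists (z0 r), (z1 r), (z2 r); split=> //.
- move=> x xd.
  have E0 j : e j.+1 x = 0 by apply: e_lo; apply: le_trans xd _; rewrite ler_peMl ?ler1n// ltW.
  rewrite /z0 /z1 /z2 /H /k1 /k2 (eta_lo xd) !E0.
  by rewrite !(subr0, mul1r, mul0r, mulr0, addr0).
- move=> x xd.
  have E1 j : (j <= 8)%N -> e j x = 1.
    by move=> j8; apply: e_hi; apply: le_trans xd; rewrite ler_pM2r// ler_nat.
  rewrite /z0 /z1 /z2 /H /k1 /k2 (eta_hi xd) !E1//.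
  by rewrite !(subrr, mul1r, mul0r, mulr0, addr0, add0r).
move=> x /[dup] xin /andP[x0 x10].
have sr0 r' : 0 <= r' ^+ 2 * derive1 eta x by rewrite mulr_ge0// sqr_ge0.
have slope_le (u : R) : 0 < sg * u ->
    c ^+ 2 * u ^+ 2 <= c ^+ 2 * (u + sg * r ^+ 2 * derive1 eta x) ^+ 2.
  move=> u0; rewrite ler_pM2l ?exprn_gt0//.
  have sqS (t : R) : t ^+ 2 = (sg * t) ^+ 2 by rewrite exprMn (expr2 sg) sg1 mul1r.
  rewrite sqS [leRHS]sqS mulrDr !mulrA sg1 mul1r.
  have u0' := ltW u0; have sr1 : 0 <= r * r * derive1 eta x := sr0 r.
  by rewrite lerXn2r ?nnegrE ?addr_ge0 ?lerDl.
have [x2|x2] := leP x (2 * d).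
  have lo j : x <= j.+2%:R * d.
    by apply: le_trans x2 _; rewrite ler_pM2r// ler_nat.
  have E0 j : e j.+2 x = 0 by exact: e_lo.
  have D0 j : derive1 (e j.+2) x = 0 by apply: de_out; left.
  have Hp p q : H p q x = p x by rewrite /H !E0 subr0 mul1r mul0r addr0.
  have dHp p q : smooth p -> smooth q -> derive1 (H p q) x = derive1 p x.
    by move=> sp sq; rewrite (dH x sp sq) !E0 !D0 oppr0 !(mul0r, addr0, mul1r, add0r).
  have /ptl[h1 h2] : 0 <= x <= 2 * d by rewrite x0.
  have -> : speed2 (z1 r) (z2 r) x = speed2 p1 p2 x.
    by rewrite /speed2 dz1 dz2 dk1 dk2 (dHp _ _ sp1 sq1) (dHp _ _ sp2 sq2) !D0 subrr !mulr0 !addr0.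
  rewrite slope_z /slope Hp (dHp _ _ sp0 sq0) (dHp _ _ sp1 sq1).
  exact: (lt_le_trans h1 (slope_le _ h2)).
have [x8|x8] := leP (8 * d) x.
  have E1 j : (j <= 7)%N -> e j x = 1.
    by move=> j8; apply: e_hi; apply: le_trans x8; rewrite ler_pM2r// ler_nat.
  have D0 j : (j <= 7)%N -> derive1 (e j) x = 0.
    by move=> j8; apply: de_out; right; apply: le_trans x8; rewrite ler_pM2r// ler_nat.
  have Hq p q : H p q x = q x by rewrite /H !E1// subrr mul0r mul1r add0r.
  have dHq p q : smooth p -> smooth q -> derive1 (H p q) x = derive1 q x.
    move=> sp sq; rewrite (dH x sp sq) !E1// !D0//.
    by rewrite oppr0 subrr !(mul0r, mul1r, add0r).
  have /qtl[h1 h2] : 8 * d <= x <= 10 * d by rewrite x8.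
  have -> : speed2 (z1 r) (z2 r) x = speed2 q1 q2 x.
    by rewrite /speed2 dz1 dz2 dk1 dk2 (dHq _ _ sp1 sq1) (dHq _ _ sp2 sq2) !D0// subrr !mulr0 !addr0.
  rewrite slope_z /slope Hq (dHq _ _ sp0 sq0) (dHq _ _ sp1 sq1).
  exact: (lt_le_trans h1 (slope_le _ h2)).
rewrite slope_z /speed2 dz1 dz2.
have leM (t M' : R) : `|t| <= M' -> M' <= M -> `|t| <= M by move=> h; exact: le_trans.
apply: hr => //.
- by apply: leM (hM1 _ xin) _; rewrite /M -!addrA lerDl !addr_ge0.
- by apply: leM (hM3 _ xin) _; rewrite /M -addrA -(addrA _ M3) addrCA lerDl !addr_ge0.
- by apply: leM (hM2 _ xin) _; rewrite /M -!addrA addrCA lerDl !addr_ge0.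
- by apply: leM (hM4 _ xin) _; rewrite /M addrAC lerDr !addr_ge0.
- by apply: leM (hM5 _ xin) _; rewrite /M lerDr !addr_ge0.
- by apply: hm; rewrite !ltW.
Qed.

End Connecting.

End Closing.

(** * One-sided derivatives and gluing *)

Section Towers.
Context {R : realType} {N : nat}.
Implicit Types (D : set R) (f g w : R -> 'rV[R]_N) (l : 'rV[R]_N) (t : R).

Lemma quotientP D w t l :
  quotient D w t --> l <->
  forall e : R, 0 < e -> exists2 d : R, 0 < d &
    forall s, D s -> s != t -> `|s - t| < d ->
      `|l - (s - t)^-1 *: (w s - w t)| <= e.
Proof.
rewrite /quotient; split => [|H].
  move=> /cvgrPdist_le H e /H[d /= d0 Hd]; exists d => // s Ds st sd.
  by apply: Hd => //; rewrite /ball_ /= distrC.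
apply/cvgrPdist_le => /= e /H[d d0 Hd]; exists d => //= s.
by rewrite /ball_ /= distrC => sd st Ds; exact: Hd.
Qed.

(** A nondegenerate interval has points other than [t] arbitrarily close to [t], to its right if
    [t < b] and to its left otherwise. This identifies the [lim] in [derive_within] with any limit
    that has been found. *)
Lemma quotient_cvg_unique (a b t : R) w l l' : a < b -> a <= t <= b ->
  quotient `[a, b] w t --> l -> quotient `[a, b] w t --> l' -> l = l'.
Proof.
move=> ab /andP[at_ tb] /quotientP H /quotientP H'; apply/eqP.
rewrite -subr_eq0 -normr_le0; apply/ler_addgt0Pl => e e0; rewrite addr0.
have e2 : 0 < e / 2 by rewrite divr_gt0.
have [d d0 Hd] := H _ e2.
have [d' d'0 Hd'] := H' _ e2.
pose m := Num.min d d'.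
have m0 : 0 < m by rewrite lt_min d0.
have [s [sab st]] : exists s, (`[a, b]%classic s) /\ (s != t) /\ `|s - t| < m.
  have [tb'|bt] := ltP t b.
    exists (t + Num.min (b - t) (m / 2)).
    have h : 0 < Num.min (b - t) (m / 2) by rewrite lt_min subr_gt0 tb' divr_gt0.
    have h1 : Num.min (b - t) (m / 2) <= b - t by rewrite ge_min lexx.
    have h2 : Num.min (b - t) (m / 2) <= m / 2 by rewrite ge_min lexx orbT.
    split; first by rewrite /= in_itv /=; apply/andP; split; lra.
    split; first by rewrite gt_eqF//; lra.
    by rewrite addrC addKr gtr0_norm//; lra.
  exists (t - Num.min (t - a) (m / 2)).
  have ta : 0 < t - a by lra.
  have h : 0 < Num.min (t - a) (m / 2) by rewrite lt_min ta divr_gt0.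
  have h1 : Num.min (t - a) (m / 2) <= t - a by rewrite ge_min lexx.
  have h2 : Num.min (t - a) (m / 2) <= m / 2 by rewrite ge_min lexx orbT.
  split; first by rewrite /= in_itv /=; apply/andP; split; lra.
  split; first by rewrite lt_eqF//; lra.
  by rewrite addrC addKr normrN gtr0_norm//; lra.
move: st => [st]; rewrite lt_min => /andP[sd sd'].
have h1 := Hd s sab st sd; have h2 := Hd' s sab st sd'.
move: h1 h2; set q := _ *: _ => h1 h2.
have -> : l - l' = (l - q) - (l' - q) by rewrite opprB addrA subrK.
by apply: le_trans (ler_normB _ _) _; lra.
Qed.

Lemma eq_quotient D f g t l : {in D, f =1 g} -> D t ->
  quotient D f t --> l -> quotient D g t --> l.
Proof.
move=> fg Dt /quotientP H; apply/quotientP => e /H[d d0 Hd].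
exists d => // s Ds st sd; rewrite -!fg ?inE//; exact: Hd.
Qed.

(* Since [derive_within_n] is junk off the interval, derivatives of a path are
   handled through sequences [F] of functions that are its successive derivatives. *)
Definition tower (r : regularity) (a b : R) (F : nat -> R -> 'rV[R]_N) : Prop :=
  forall k : nat,
    (reg_le k.+1 r -> forall t, a <= t <= b -> quotient `[a, b] (F k) t --> F k.+1 t) /\
    (reg_le k r -> {within `[a, b], continuous (F k)}).

Lemma reg_leW k r : reg_le k.+1 r -> reg_le k r.
Proof. by case: r => //= l; exact: ltnW. Qed.

Lemma Cr_path_tower r a b w : Cr_path r a b w ->
  tower r a b (fun k => derive_within_n `[a, b] k w).
Proof. by move=> H k; have [h1 h2] := H k; split. Qed.

(** Quotients within the interval see only values there, so agreement on [a, b] passes from one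
    order to the next. *)
Lemma tower_derive r a b F w : a < b -> tower r a b F ->
  (forall t, a <= t <= b -> w t = F 0%N t) ->
  forall k, reg_le k r -> forall t, a <= t <= b ->
    derive_within_n `[a, b] k w t = F k t.
Proof.
move=> ab TF wF; elim=> [|k IH] kr t tab; first exact: wF.
have IHk := IH (reg_leW kr).
have h : quotient `[a, b] (derive_within_n `[a, b] k w) t --> F k.+1 t.
  apply: (@eq_quotient _ (F k)) => [s||]; last exact: (TF k).1.
    by rewrite inE /= in_itv /= => sab; rewrite IHk.
  by rewrite /= in_itv.
rewrite [LHS]/(lim _); apply: (quotient_cvg_unique (w := derive_within_n `[a, b] k w) ab tab) => //.
by apply/cvg_ex; exists (F k.+1 t).
Qed.

Lemma tower_Cr_path r a b F w : a < b -> tower r a b F ->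
  (forall t, a <= t <= b -> w t = F 0%N t) -> Cr_path r a b w.
Proof.
move=> ab TF wF k; have TD := tower_derive ab TF wF; split=> [kr t tab|kr].
  apply/cvg_ex; exists (F k.+1 t).
  apply: (@eq_quotient _ (F k)) => [s||]; last exact: (TF k).1.
    by rewrite inE /= in_itv /= => sab; rewrite TD//; exact: reg_leW.
  by rewrite /= in_itv.
apply: (subspace_eq_continuous (f := F k)); last exact: (TF k).2.
by move=> s; rewrite inE /= in_itv /= => sab; apply/esym/TD.
Qed.

(** Away from [b] small neighbourhoods lie on one side. At [b] the quotients from the left and from
    the right have the limits [F k.+1 b] and [G k.+1 b], which agree by hypothesis. *)
Lemma tower_glue r a b c F G : a < b -> b < c ->
  tower r a b F -> tower r b c G -> (forall k, reg_le k r -> F k b = G k b) ->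
  tower r a c (fun k t => if t <= b then F k t else G k t).
Proof.
move=> ab bc TF TG FG k; split=> [kr t /andP[at_ tc]|kr].
  apply/quotientP => e e0.
  have kr' := reg_leW kr; have FGk := FG k kr'.
  have HF : t <= b -> exists2 d : R, 0 < d & forall s : R, a <= s <= b -> s != t -> `|s - t| < d ->
      `|F k.+1 t - (s - t)^-1 *: (F k s - F k t)| <= e.
    move=> tb; have tab : a <= t <= b by rewrite at_.
    have /quotientP/(_ e e0)[d d0 Hd] := (TF k).1 kr t tab; by exists d.
  have HG : b <= t -> exists2 d : R, 0 < d & forall s : R, b <= s <= c -> s != t -> `|s - t| < d ->
      `|G k.+1 t - (s - t)^-1 *: (G k s - G k t)| <= e.
    move=> bt; have tbc : b <= t <= c by rewrite bt.
    have /quotientP/(_ e e0)[d d0 Hd] := (TG k).1 kr t tbc; by exists d.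
  have [tb|bt|tb] := ltgtP t b.
  - have [d d0 Hd] := HF (ltW tb); exists (Num.min d (b - t)).
      by rewrite lt_min d0 subr_gt0.
    move=> s /=; rewrite in_itv /= => /andP[as_ sc] st; rewrite lt_min => /andP[sd sb].
    have sb' : s <= b by move: sb; rewrite ltr_norml => /andP[]; lra.
    by rewrite sb'; apply: Hd => //; rewrite as_.
  - have [d d0 Hd] := HG (ltW bt); exists (Num.min d (t - b)).
      by rewrite lt_min d0 subr_gt0.
    move=> s /=; rewrite in_itv /= => /andP[as_ sc] st; rewrite lt_min => /andP[sd sb].
    have sb' : b < s by move: sb; rewrite ltr_norml => /andP[]; lra.
    by rewrite (leNgt s b) sb' /=; apply: Hd => //; rewrite ltW.
  - subst t; have [d d0 Hd] := HF (lexx _); have [d' d'0 Hd'] := HG (lexx _).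
    exists (Num.min d d'); first by rewrite lt_min d0.
    move=> s /=; rewrite in_itv /= => /andP[as_ sc] st; rewrite lt_min => /andP[sd sd'].
    have [sb|bs] := leP s b; first by apply: Hd => //; rewrite as_.
    by rewrite FG// FGk; apply: Hd' => //; rewrite ltW.
have acU : `[a, c]%classic = `[a, b]%classic `|` `[b, c]%classic.
  apply/seteqP; split=> s /=; rewrite !in_itv /=.
    by move=> /andP[h1 h2]; have [h|h] := leP s b; [left|right]; rewrite ?h1 ?h2 ?ltW.
  by move=> [|] /andP[h1 h2]; apply/andP; split; lra.
rewrite acU; apply: withinU_continuous.
- exact: itv_closed.
- exact: itv_closed.
- apply: (subspace_eq_continuous (f := F k)); last exact: (TF k).2.
  move=> s; rewrite inE /= in_itv /= => /andP[_ sb].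
  by rewrite -[RHS]/(if s <= b then F k s else G k s) sb.
- apply: (subspace_eq_continuous (f := G k)); last exact: (TG k).2.
  move=> s; rewrite inE /= in_itv /= => /andP[bs _].
  rewrite -[RHS]/(if s <= b then F k s else G k s).
  have [sb|//] := leP s b; have -> : s = b by apply/eqP; rewrite eq_le sb.
  by rewrite FG.
Qed.

Lemma smooth_tower_row r a b (z : 'I_N -> R -> R) : (forall i, smooth (z i)) ->
  tower r a b (fun k t => \row_i (z i)^`(k)%classic t).
Proof.
move=> sz k; split=> [_ t _|_]; last first.
  apply: continuous_subspaceT => t; apply: cvg_row => i.
  rewrite mxE (_ : (fun _ => _) = (z i)^`(k)%classic); last first.
    by apply/funext => x; rewrite mxE.
  exact/smooth_continuous/smooth_derive1n.
have dz i : is_derive t (1 : R) (fun y => (\row_i (z i)^`(k)%classic y : 'rV[R]_N) 0 i)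
    ((\row_i (z i)^`(k.+1)%classic t : 'rV[R]_N) 0 i).
  rewrite mxE (_ : (fun _ => _) = (z i)^`(k)%classic); last first.
    by apply/funext => x; rewrite mxE.
  exact: smooth_is_derive.
have /cvg_ex[l] : derivable (fun y => \row_i (z i)^`(k)%classic y : 'rV[R]_N) t (1 : R).
  by apply/derivable_mxP => i j; rewrite ord1; case: (dz j).
move=> hl; have E : l = \row_i (z i)^`(k.+1)%classic t.
  have dl := cvg_lim _ hl.
  have : 'D_(1 : R) (fun y => \row_i (z i)^`(k)%classic y : 'rV[R]_N) t = l by exact: dl.
  rewrite derive_mx; last by apply/cvg_ex; exists l.
  move=> <-; apply/rowP => i; rewrite [LHS]mxE; case: (dz i) => _ ->.
  by rewrite mxE.
apply/quotientP => e e0; move/cvgrPdist_le : hl => /(_ e e0)[d /= d0 Hd].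
exists d => // s _ st sd; rewrite -E.
have := Hd (s - t); rewrite /ball_ /= sub0r normrN subr_eq0 => /(_ sd st).
by rewrite [(s - t)%:A]mulr1 subrK.
Qed.

End Towers.

(** * The metric and its curvature *)

Section Metric.
Context {R : realType}.
Implicit Types (c X : R) (i j k l : nat).

(* Tensor components as functions of X = x_2, on which alone they depend; the
   indices >= 3 are those of the euclidean factor. *)
Definition metN c i j X : R :=
  match i, j with
  | 0, 0 => - c ^+ 2
  | 0, 1 | 1, 0 => - (c ^+ 2 * X)
  | 1, 1 => 1 - c ^+ 2 * X ^+ 2
  | _, _ => (i == j)%:R
  end.

Definition dmetN c i j X : R :=
  match i, j with
  | 0, 1 | 1, 0 => - c ^+ 2
  | 1, 1 => - (2 * c ^+ 2 * X)
  | _, _ => 0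
  end.

Definition imetN c i j X : R :=
  match i, j with
  | 0, 0 => X ^+ 2 - c ^- 2
  | 0, 1 | 1, 0 => - X
  | _, _ => (i == j)%:R
  end.

Definition chrN c k i j X : R :=
  match k, i, j with
  | 0, 1, 2 | 0, 2, 1 => 2^-1 * (1 + c ^+ 2 * X ^+ 2)
  | 0, 0, 2 | 0, 2, 0 => 2^-1 * c ^+ 2 * X
  | 1, 1, 2 | 1, 2, 1 => - (2^-1 * c ^+ 2 * X)
  | 1, 0, 2 | 1, 2, 0 => - (2^-1 * c ^+ 2)
  | 2, 0, 1 | 2, 1, 0 => 2^-1 * c ^+ 2
  | 2, 1, 1 => c ^+ 2 * X
  | _, _, _ => 0
  end.

Definition dchrN c k i j X : R :=
  match k, i, j with
  | 0, 1, 2 | 0, 2, 1 => c ^+ 2 * X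
  | 0, 0, 2 | 0, 2, 0 => 2^-1 * c ^+ 2
  | 1, 1, 2 | 1, 2, 1 => - (2^-1 * c ^+ 2)
  | 2, 1, 1 => c ^+ 2
  | _, _, _ => 0
  end.

Definition ricN c i j X : R :=
  2^-1 * c ^+ 2 *
  match i, j with
  | 0, 0 => c ^+ 2
  | 0, 1 | 1, 0 => c ^+ 2 * X
  | 1, 1 => 1 + c ^+ 2 * X ^+ 2
  | 2, 2 => 1
  | _, _ => 0
  end.

(** All metric components and Christoffel symbols are polynomials of degree at most two in x2, so
    this covers both tables. *)
Lemma is_derive_quadratic (a b e X : R) (f : R -> R) df :
  (forall Y, f Y = a + b * Y + e * Y ^+ 2) -> df = b + 2 * e * X ->
  is_derive X (1 : R) f df.
Proof.
move=> fE ->; rewrite (_ : f = horner (a%:P + b *: 'X + e *: 'X^2)); last first.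
  by apply/funext => Y; rewrite fE !hornerE.
apply: (is_derive_eq (is_derive_poly _ _)).
by rewrite !(derivD, derivZ, derivC, derivX, derivXn) !hornerE /=; ring.
Qed.

Lemma is_derive_metN c i j X : is_derive X (1 : R) (metN c i j) (dmetN c i j X).
Proof.
case: i => [|[|i]]; case: j => [|[|j]].
- by apply: (is_derive_quadratic (a := - c ^+ 2) (b := 0) (e := 0)) => [Y|] /=; ring.
- by apply: (is_derive_quadratic (a := 0) (b := - c ^+ 2) (e := 0)) => [Y|] /=; ring.
- exact: is_derive_cst.
- by apply: (is_derive_quadratic (a := 0) (b := - c ^+ 2) (e := 0)) => [Y|] /=; ring.
- by apply: (is_derive_quadratic (a := 1) (b := 0) (e := - c ^+ 2)) => [Y|] /=; ring.
- exact: is_derive_cst.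
- exact: is_derive_cst.
- exact: is_derive_cst.
- exact: is_derive_cst.
Qed.

Lemma is_derive_chrN c k i j X : is_derive X (1 : R) (chrN c k i j) (dchrN c k i j X).
Proof.
case: k i j => [|[|[|k]]] [|[|[|i]]] [|[|[|j]]]; try exact: is_derive_cst;
  first [ apply: (is_derive_quadratic (a := 0) (b := 2^-1 * c ^+ 2) (e := 0)) => [Y|] /=; by ring
        | apply: (is_derive_quadratic (a := 2^-1) (b := 0) (e := 2^-1 * c ^+ 2)) => [Y|] /=; by field
        | apply: (is_derive_quadratic (a := 0) (b := - (2^-1 * c ^+ 2)) (e := 0)) => [Y|] /=; by ring
        | apply: (is_derive_quadratic (a := 0) (b := c ^+ 2) (e := 0)) => [Y|] /=; by ring].
Qed.

Lemma I3P (k : 'I_3) : [\/ k = i0, k = i1 | k = i2].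
Proof.
by case: k => [[|[|[|//]]] hk]; [constructor 1|constructor 2|constructor 3]; exact: val_inj.
Qed.

Lemma sum3 (V : zmodType) (F : 'I_3 -> V) : \sum_i F i = F i0 + F i1 + F i2.
Proof.
by rewrite !big_ord_recl big_ord0 addr0 addrA; congr (F _ + F _ + F _); exact: val_inj.
Qed.

(** Turns index sums in indeterminate dimension into three explicit terms, after which curvature is
    a finite check. *)
Lemma sum_first3 m (F : nat -> R) : (forall i, F i.+3 = 0) ->
  \sum_(i < 3 + m) F i = F 0%N + F 1%N + F 2%N.
Proof.
move=> F0; rewrite !big_ord_recl big1 => [|i _]; first by rewrite addr0 !addrA.
exact: F0.
Qed.

Lemma sum_split3 m (F : 'I_(3 + m) -> R) : \sum_i F i =
  F (lshift m i0) + F (lshift m i1) + F (lshift m i2) + \sum_(k < m) F (rshift 3 k).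
Proof.
by rewrite big_split_ord /= sum3.
Qed.

(** * Curvature and energy conditions in dimension 3 + m *)

Section Dimension.
Variables (c : R) (m : nat).
Hypothesis c0 : 0 < c.
Implicit Types (x v w : 'rV[R]_(3 + m)).

Definition x2 x : R := x 0 (lshift m i2).

Lemma invmx_frame (y : 'rV[R]_3) : invmx (frame c y) =
  \matrix_(i < 3, j < 3)
    nth 0 (nth [::] [:: [:: c; 0; 0]; [:: c * y 0 i2; 1; 0]; [:: 0; 0; 1]] i) j.
Proof.
set M := (RHS); have Fu := frame_unit y c0.
suff MF : M *m frame c y = 1%:M by rewrite -[RHS]mulmx1 -(mulmxV Fu) mulmxA MF mul1mx.
apply/matrixP => i j; rewrite !mxE sum3 /= !mxE /=.
have cn := lt0r_neq0 c0.
by case: (I3P i) => ->; case: (I3P j) => -> /=; field.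
Qed.

(** The components of v in the frame are [v *m cofr x]; hence a tensor
    [cofr x *m diag_mx d *m (cofr x)^T] is the one that is diagonal in the frame with entries d. *)
Definition cofr x : 'M[R]_(3 + m) := block_mx (invmx (frame c (lsubmx x))) 0 0 1%:M.
Definition fr x : 'M[R]_(3 + m) := block_mx (frame c (lsubmx x)) 0 0 1%:M.
Definition sgn : 'rV[R]_(3 + m) := row_mx (eps R) (const_mx 1).

Lemma cofr_fr x : cofr x *m fr x = 1%:M.
Proof.
rewrite mulmx_block !(mulmx0, mul0mx, addr0, add0r) mulmx1 mulVmx ?frame_unit//.
by rewrite -scalar_mx_block.
Qed.

Lemma fr_cofr x : fr x *m cofr x = 1%:M.
Proof. exact/mulmx1C/cofr_fr. Qed.

Lemma gE x : g c m x = cofr x *m diag_mx sgn *m (cofr x)^T.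
Proof.
rewrite /g /g3 /sgn diag_mx_row /cofr tr_block_mx !mulmx_block.
rewrite !(mulmx0, mul0mx, addr0, add0r, trmx0, trmx1, mul1mx, mulmx1).
by congr block_mx; apply/matrixP => i j; rewrite !mxE.
Qed.

Lemma invmx_g x : invmx (g c m x) = (fr x)^T *m diag_mx sgn *m fr x.
Proof.
have ss : diag_mx sgn *m diag_mx sgn = 1%:M.
  rewrite mulmx_diag -diag_const_mx; congr diag_mx; apply/rowP => i; rewrite !mxE.
  by case: fintype.split => k; rewrite !mxE ?mulr1//; case: eqP; rewrite ?mulrNN mulr1.
have MG : (fr x)^T *m diag_mx sgn *m fr x *m g c m x = 1%:M.
  rewrite gE !mulmxA -[X in X *m diag_mx sgn *m _]mulmxA fr_cofr mulmx1.
  by rewrite -[X in X *m _]mulmxA ss mulmx1 -trmx_mul cofr_fr trmx1.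
have Gu : g c m x \in unitmx by case/mulmx1_unit: MG.
by rewrite -[RHS]mulmx1 -(mulmxV Gu) mulmxA MG mul1mx.
Qed.

Lemma row_cofr x v (i : 'I_(3 + m)) : (v *m cofr x) 0 i =
  if i == 0%N :> nat then c * (v 0 (lshift m i0) + x2 x * v 0 (lshift m i1)) else v 0 i.
Proof.
rewrite -{1}[v]hsubmxK mul_row_block !(mulmx0, add0r, addr0) mulmx1.
case: (split_ordP i) => k ->; last by rewrite row_mxEr mxE.
rewrite row_mxEl mxE sum3 invmx_frame !mxE /=.
by case: (I3P k) => -> /=; rewrite /x2; ring.
Qed.

Lemma g_metN x (i j : 'I_(3 + m)) : g c m x i j = metN c i j (x2 x).
Proof.
rewrite /g; case: (split_ordP i) => i' ->; case: (split_ordP j) => j' ->.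
- rewrite block_mxEul /g3 invmx_frame !mxE sum3 !mxE !sum3 !mxE /= /x2.
  by case: (I3P i') => ->; case: (I3P j') => -> /=; ring.
- by rewrite block_mxEur mxE /=; case: (I3P i') => ->.
- by rewrite block_mxEdl mxE /=; case: (I3P j') => ->.
- by rewrite block_mxEdr mxE -val_eqE.
Qed.

Lemma invmx_g_imetN x (i j : 'I_(3 + m)) :
  invmx (g c m x) i j = imetN c i j (x2 x).
Proof.
rewrite invmx_g /sgn diag_mx_row /fr tr_block_mx !mulmx_block.
rewrite !(mulmx0, mul0mx, addr0, add0r, trmx0, trmx1, mul1mx, mulmx1).
case: (split_ordP i) => i' ->; case: (split_ordP j) => j' ->.
- rewrite block_mxEul !mxE sum3 ?mxE ?sum3 ?mxE ?sum3 ?mxE /= ?mxE /= /x2.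
  have cn := lt0r_neq0 c0.
  by case: (I3P i') => ->; case: (I3P j') => ->; rewrite /= ?mxE /=; field.
- by rewrite block_mxEur mxE /=; case: (I3P i') => ->.
- by rewrite block_mxEdl mxE /=; case: (I3P j') => ->.
- by rewrite block_mxEdr !mxE -val_eqE.
Qed.

Lemma partial_x2 (i : 'I_(3 + m)) (f : R -> R) df x : is_derive (x2 x) (1 : R) f df ->
  partial i (fun y => f (x2 y)) x = if i == 2%N :> nat then df else 0.
Proof.
move=> [dd dE]; rewrite /partial derive_scalar_comp; last 2 first.
- exact/derivable1_diffP.
- exact: differentiable_coord.
rewrite derive_coord mxE eqxx /= derive1E dE -val_eqE /= eq_sym.
by case: eqP; rewrite ?mulr1 ?mulr0.
Qed.

Lemma partial_metN (k i j : 'I_(3 + m)) x : partial k (fun y => g c m y i j) x =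
  if k == 2%N :> nat then dmetN c i j (x2 x) else 0.
Proof.
rewrite (_ : (fun y => _) = fun y => metN c i j (x2 y)).
  exact/partial_x2/is_derive_metN.
by apply/funext => y; exact: g_metN.
Qed.

Lemma christoffel_chrN (k i j : 'I_(3 + m)) x :
  christoffel (g c m) k i j x = chrN c k i j (x2 x).
Proof.
rewrite /christoffel; set X := x2 x.
pose d (k i j : nat) := if k == 2%N then dmetN c i j X else 0.
transitivity (2^-1 * \sum_(l < 3 + m) imetN c k l X * (d i j l + d j i l - d l i j)).
  by congr (_ * _); apply: eq_bigr => l _; rewrite invmx_g_imetN !partial_metN.
have d3 (i' k' : nat) : dmetN c i' k'.+3 X = 0 by case: i' => [|[|i']].
rewrite (@sum_first3 m (fun l => imetN c k l X * (d i j l + d j i l - d l i j))); last first.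
  by move=> l; rewrite /d /= !d3 !if_same !addr0 subr0 mulr0.
have cn := lt0r_neq0 c0.
case: k i j => [[|[|[|k]]] hk] [[|[|[|i]]] hi] [[|[|[|j]]] hj]; rewrite /d /=; by field.
Qed.

Lemma partial_chrN (l k i j : 'I_(3 + m)) x :
  partial l (christoffel (g c m) k i j) x =
  if l == 2%N :> nat then dchrN c k i j (x2 x) else 0.
Proof.
rewrite (_ : christoffel _ _ _ _ = fun y => chrN c k i j (x2 y)).
  exact/partial_x2/is_derive_chrN.
by apply/funext => y; exact: christoffel_chrN.
Qed.

Lemma ricci_ricN x (i j : 'I_(3 + m)) : ricci (g c m) x i j = ricN c i j (x2 x).
Proof.
rewrite mxE; set X := x2 x.
pose d (l k i j : nat) := if l == 2%N then dchrN c k i j X else 0.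
pose T (k p : nat) := chrN c k k p X * chrN c p i j X - chrN c k i p X * chrN c p k j X.
pose S (k : nat) := d k k i j - d i k k j + (T k 0%N + T k 1%N + T k 2%N).
have T3 k p : T k p.+3 = 0.
  rewrite /T; have -> : chrN c k k p.+3 X = 0 by case: k => [|[|[|k]]].
  have -> : chrN c k i p.+3 X = 0 by case: k => [|[|[|k]]]; case: (nat_of_ord i) => [|[|[|i']]].
  by rewrite !mul0r subr0.
transitivity (\sum_(k < 3 + m) S k).
  apply: eq_bigr => k _; rewrite /riemann !partial_chrN; congr (_ + _).
  rewrite -(sum_first3 m (T3 k)); apply: eq_bigr => p _.
  by rewrite !christoffel_chrN.
rewrite sum_first3 => [|k]; last first.
  by rewrite /S /d /T /= !(mul0r, subr0, addr0) if_same subr0.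
rewrite /S /d /T; case: i j {T3 T S d} => [[|[|[|i]]] hi] [[|[|[|j]]] hj]; rewrite /ricN /=; by field.
Qed.

Lemma mulmx_diag_tr p (a b d : 'rV[R]_p) :
  (a *m diag_mx d *m b^T) 0 0 = \sum_i d 0 i * (a 0 i * b 0 i).
Proof.
rewrite mul_mx_diag !mxE; apply: eq_bigr => i _; rewrite !mxE.
by rewrite mulrA (mulrC _ (d 0 i)).
Qed.

Lemma cofr_sandwich x v (d : 'rV[R]_(3 + m)) :
  (v *m (cofr x *m diag_mx d *m (cofr x)^T) *m v^T) 0 0 =
  d 0 (lshift m i0) * (c * (v 0 (lshift m i0) + x2 x * v 0 (lshift m i1))) ^+ 2
  + d 0 (lshift m i1) * v 0 (lshift m i1) ^+ 2
  + d 0 (lshift m i2) * v 0 (lshift m i2) ^+ 2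
  + \sum_(k < m) d 0 (rshift 3 k) * v 0 (rshift 3 k) ^+ 2.
Proof.
have -> : v *m (cofr x *m diag_mx d *m (cofr x)^T) *m v^T =
    (v *m cofr x) *m diag_mx d *m (v *m cofr x)^T by rewrite trmx_mul !mulmxA.
rewrite mulmx_diag_tr sum_split3 !row_cofr /= -!expr2; congr (_ + _).
by apply: eq_bigr => k _; rewrite row_cofr /= -expr2.
Qed.

Lemma ev2_g x v : ev2 (g c m) x v v =
  - (c * (v 0 (lshift m i0) + x2 x * v 0 (lshift m i1))) ^+ 2
  + v 0 (lshift m i1) ^+ 2 + v 0 (lshift m i2) ^+ 2
  + \sum_(k < m) v 0 (rshift 3 k) ^+ 2.
Proof.
rewrite /ev2 gE cofr_sandwich !row_mxEl !mxE /= mulN1r !mul1r; congr (_ + _).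
by apply: eq_bigr => k _; rewrite row_mxEr mxE mul1r.
Qed.

Definition rsgn : 'rV[R]_(3 + m) := row_mx (const_mx (2^-1 * c ^+ 2)) 0.

Lemma ricciE x : ricci (g c m) x = cofr x *m diag_mx rsgn *m (cofr x)^T.
Proof.
apply/matrixP => i j; rewrite ricci_ricN /rsgn diag_mx_row /cofr tr_block_mx !mulmx_block.
rewrite !(mulmx0, mul0mx, addr0, add0r, trmx0, trmx1, mul1mx, mulmx1).
case: (split_ordP i) => i' ->; case: (split_ordP j) => j' ->.
- rewrite block_mxEul invmx_frame !mxE sum3 !mxE !sum3 !mxE /= /ricN /x2.
  by case: (I3P i') => ->; case: (I3P j') => -> /=; ring.
- by rewrite block_mxEur mxE /ricN /=; case: (I3P i') => -> /=; rewrite mulr0.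
- by rewrite block_mxEdl mxE /ricN /= mulr0.
- by rewrite block_mxEdr !mxE /ricN /= mulr0 mul0rn.
Qed.

(** By cyclicity of the trace frame and coframe cancel, leaving the sum of the products of [sgn] and
    [rsgn]: the timelike direction counts negatively, so the value is (-1 + 1 + 1) c^2 / 2. *)
Lemma scal_g x : scal (g c m) x = 2^-1 * c ^+ 2.
Proof.
have ricT : (ricci (g c m) x)^T = ricci (g c m) x.
  by rewrite ricciE !trmx_mul trmxK tr_diag_mx mulmxA.
transitivity (\tr (invmx (g c m x) *m (ricci (g c m) x)^T)).
  by apply: eq_bigr => i _; rewrite mxE; apply: eq_bigr => j _; rewrite [in RHS]mxE.
rewrite ricT ricciE invmx_g -!mulmxA [fr x *m _]mulmxA fr_cofr mul1mx.
rewrite mxtrace_mulC -!mulmxA -trmx_mul fr_cofr trmx1 mulmx1 mulmx_diag.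
rewrite mxtrace_diag sum_split3 big1 => [|k _].
  by rewrite !mxE !(unsplitK (inl _)) !mxE /=; ring.
by rewrite !mxE (unsplitK (inr k)) !mxE mulr0.
Qed.

Definition tsgn L : 'rV[R]_(3 + m) :=
  \row_i (rsgn 0 i + (L - 4^-1 * c ^+ 2) * sgn 0 i).

Lemma energy_momentumE L x : energy_momentum (g c m) L x =
  cofr x *m diag_mx (tsgn L) *m (cofr x)^T.
Proof.
have -> : diag_mx (tsgn L) = diag_mx rsgn + (L - 4^-1 * c ^+ 2) *: diag_mx sgn.
  by rewrite -linearZ -linearD; congr diag_mx; apply/rowP => i; rewrite !mxE.
rewrite /energy_momentum scal_g ricciE gE mulmxDr mulmxDl -addrA -scaleNr -scalerDl.
by rewrite -scalemxAr -scalemxAl; congr (_ + _ *: _); field.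
Qed.

Let S v := \sum_(k < m) v 0 (rshift 3 k) ^+ 2.
Let S_ge0 v : 0 <= S v. Proof. by apply: sumr_ge0 => k _; exact: sqr_ge0. Qed.

Lemma timelike_convergence_g : timelike_convergence (g c m).
Proof.
move=> x v _; rewrite /ev2 ricciE cofr_sandwich !row_mxEl !mxE.
have C0 : 0 <= 2^-1 * c ^+ 2 by rewrite mulr_ge0 ?invr_ge0// sqr_ge0.
have Q u : 0 <= 2^-1 * c ^+ 2 * u ^+ 2 by rewrite mulr_ge0// sqr_ge0.
apply: addr_ge0; first by apply: addr_ge0 => //; exact: addr_ge0.
by apply: sumr_ge0 => k _; rewrite row_mxEr mxE mul0r.
Qed.

(** Put p = c^2 / 2 and mu = c^2 / 4 - L >= 0. In the frame T has the entries p + mu, p - mu, p -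
    mu, and - mu on the euclidean factor; the timelike entry is the largest in absolute value. *)
Lemma dominant_energy_g L : L <= c ^+ 2 / 4 -> dominant_energy (g c m) L.
Proof.
move=> hL x v; rewrite /timelike ev2_g -/(S v); have := S_ge0 v.
set s := S v; set a := c * _; set b1 : R := v 0 _; set b2 : R := v 0 _ => s0 tl.
have t0 : tsgn L 0 (lshift m i0) = 3 / 4 * c ^+ 2 - L.
  by rewrite mxE !row_mxEl !mxE /=; field.
have t1 : tsgn L 0 (lshift m i1) = 4^-1 * c ^+ 2 + L.
  by rewrite mxE !row_mxEl !mxE /=; field.
have t2 : tsgn L 0 (lshift m i2) = 4^-1 * c ^+ 2 + L.
  by rewrite mxE !row_mxEl !mxE /=; field.
have t3 (k : 'I_m) : tsgn L 0 (rshift 3 k) = L - 4^-1 * c ^+ 2.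
  by rewrite mxE !row_mxEr !mxE /= add0r mulr1.
have C0 : 0 <= c ^+ 2 by rewrite sqr_ge0.
have a0 : 0 <= a ^+ 2 by rewrite sqr_ge0.
have b10 : 0 <= b1 ^+ 2 by rewrite sqr_ge0.
have b20 : 0 <= b2 ^+ 2 by rewrite sqr_ge0.
have mu0 : 0 <= c ^+ 2 / 4 - L by rewrite subr_ge0.
split.
  rewrite /ev2 energy_momentumE cofr_sandwich t0 t1 t2 -/a -/b1 -/b2.
  under eq_bigr do rewrite t3.
  rewrite -mulr_sumr -/(S v) -/s.
  (* T(v, v) = Ric(v, v) - mu g(v, v), where the last factor on the right-hand side below is - g(v,
     v) > 0. *)
  have -> : (3 / 4 * c ^+ 2 - L) * a ^+ 2 + (4^-1 * c ^+ 2 + L) * b1 ^+ 2 +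
      (4^-1 * c ^+ 2 + L) * b2 ^+ 2 + (L - 4^-1 * c ^+ 2) * s =
      2^-1 * c ^+ 2 * (a ^+ 2 + (b1 ^+ 2 + b2 ^+ 2)) +
      (c ^+ 2 / 4 - L) * (a ^+ 2 - b1 ^+ 2 - b2 ^+ 2 - s) by field.
  apply: addr_ge0; apply: mulr_ge0 => //; last lra.
    by rewrite mulr_ge0// invr_ge0.
  by apply: addr_ge0 => //; exact: addr_ge0.
apply/negP; rewrite -leNgt /sharp energy_momentumE invmx_g.
set V := - _.
have -> : ev2 (g c m) x V V = (v *m (cofr x *m
    diag_mx (\row_i (tsgn L 0 i ^+ 2 * sgn 0 i)) *m (cofr x)^T) *m v^T) 0 0.
  (* Raising the index multiplies frame components by [sgn], so g(V, V) weights the squared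
     components of v by [tsgn]^2 [sgn]. *)
  have Vc : V *m cofr x = - (v *m cofr x *m diag_mx (tsgn L) *m diag_mx sgn).
    rewrite /V mulNmx; congr (- _); rewrite -!mulmxA fr_cofr mulmx1.
    by rewrite [(cofr x)^T *m _]mulmxA -trmx_mul fr_cofr trmx1 mul1mx.
  rewrite /ev2 gE.
  have -> : V *m (cofr x *m diag_mx sgn *m (cofr x)^T) *m V^T =
      (V *m cofr x) *m diag_mx sgn *m (V *m cofr x)^T by rewrite trmx_mul !mulmxA.
  have -> : v *m (cofr x *m diag_mx (\row_i (tsgn L 0 i ^+ 2 * sgn 0 i)) *m
      (cofr x)^T) *m v^T = (v *m cofr x) *m diag_mx (\row_i (tsgn L 0 i ^+ 2 * sgn 0 i))
      *m (v *m cofr x)^T by rewrite trmx_mul !mulmxA.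
  rewrite !mulmx_diag_tr Vc; apply: eq_bigr => i _.
  have -> : (- (v *m cofr x *m diag_mx (tsgn L) *m diag_mx sgn)) 0 i =
      - ((v *m cofr x) 0 i * tsgn L 0 i * sgn 0 i).
    by rewrite mul_mx_diag mxE mxE mul_mx_diag mxE.
  have sg : sgn 0 i * sgn 0 i = 1.
    rewrite /sgn; case: (split_ordP i) => k ->; rewrite ?row_mxEl ?row_mxEr !mxE ?mulr1//.
    by case: ifP; rewrite ?mulrNN mulr1.
  rewrite [in RHS]mxE; move: ((v *m cofr x) 0 i) => A.
  transitivity (sgn 0 i * sgn 0 i * (tsgn L 0 i ^+ 2 * sgn 0 i * (A * A))); first by ring.
  by rewrite sg mul1r.
rewrite cofr_sandwich -/a -/b1 -/b2; set D := \row__ _.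
have D0 : D 0 (lshift m i0) = (3 / 4 * c ^+ 2 - L) ^+ 2 * -1.
  by rewrite mxE t0 row_mxEl mxE.
have D1 : D 0 (lshift m i1) = (4^-1 * c ^+ 2 + L) ^+ 2 * 1.
  by rewrite mxE t1 row_mxEl mxE.
have D2 : D 0 (lshift m i2) = (4^-1 * c ^+ 2 + L) ^+ 2 * 1.
  by rewrite mxE t2 row_mxEl mxE.
have D3 (k : 'I_m) : D 0 (rshift 3 k) = (L - 4^-1 * c ^+ 2) ^+ 2.
  by rewrite mxE t3 row_mxEr mxE mulr1.
rewrite D0 D1 D2; under eq_bigr do rewrite D3.
rewrite -mulr_sumr -/(S v) -/s.
set mu := c ^+ 2 / 4 - L in mu0.
have -> : 3 / 4 * c ^+ 2 - L = 2^-1 * c ^+ 2 + mu by rewrite /mu; field.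
have -> : 4^-1 * c ^+ 2 + L = 2^-1 * c ^+ 2 - mu by rewrite /mu; field.
have -> : L - 4^-1 * c ^+ 2 = - mu by rewrite /mu; field.
rewrite sqrrN; set p := 2^-1 * c ^+ 2.
have p0 : 0 <= p by rewrite mulr_ge0// invr_ge0.
have pm : 0 <= p * mu by rewrite mulr_ge0.
have e1 : 0 <= (b1 ^+ 2 + b2 ^+ 2) * (p * mu) by rewrite mulr_ge0// addr_ge0.
have e2 : 0 <= s * (p ^+ 2 + 2 * (p * mu)) by rewrite mulr_ge0// addr_ge0 ?sqr_ge0// mulr_ge0.
have e3 : 0 <= (a ^+ 2 - b1 ^+ 2 - b2 ^+ 2 - s) * (p + mu) ^+ 2.
  by rewrite mulr_ge0 ?sqr_ge0//; lra.
rewrite -subr_ge0 sub0r.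
(* Factor out (p + mu)^2 times - g(v, v); the rest comes from (p + mu)^2 - (p - mu)^2 = 4 p mu and
   (p + mu)^2 - mu^2 = p^2 + 2 p mu. *)
have -> : - ((p + mu) ^+ 2 * -1 * a ^+ 2 + (p - mu) ^+ 2 * 1 * b1 ^+ 2 +
    (p - mu) ^+ 2 * 1 * b2 ^+ 2 + mu ^+ 2 * s) =
    (a ^+ 2 - b1 ^+ 2 - b2 ^+ 2 - s) * (p + mu) ^+ 2 +
    4 * ((b1 ^+ 2 + b2 ^+ 2) * (p * mu)) + s * (p ^+ 2 + 2 * (p * mu)) by ring.
by rewrite !addr_ge0// mulr_ge0.
Qed.

End Dimension.

(** * The scaling diffeomorphism *)

Section Scaling.
Variables (c : R) (m : nat).
Hypothesis c0 : 0 < c.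
Implicit Type x : 'rV[R]_(3 + m).

Definition phi_diag : 'rV[R]_(3 + m) :=
  \row_i (if i == 0%N :> nat then c ^+ 2 else c).

Lemma phi_diag_neq0 (i : 'I_(3 + m)) : phi_diag 0 i != 0.
Proof. by rewrite mxE; case: ifP => _; rewrite ?expf_neq0// gt_eqF. Qed.

Lemma smooth_scale_row (d : 'rV[R]_(3 + m)) :
  smooth_on setT (fun x : 'rV[R]_(3 + m) => \row_i (d 0 i * x 0 i)).
Proof.
apply: smooth_on_row => i.
rewrite (_ : (fun y => _) = fun y : 'rV[R]_(3 + m) => d 0 i * y 0 i).
  by apply: smoothM; [exact: smooth_cst|exact: smooth_coord].
by apply/funext => y; rewrite mxE.
Qed.

Lemma phiE : phi c m = fun x => \row_i (phi_diag 0 i * x 0 i).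
Proof. by apply/funext => x; apply/rowP => i; rewrite !mxE. Qed.

Lemma diffeomorphism_phi : diffeomorphism (phi c m).
Proof.
split; first by rewrite phiE; exact: smooth_scale_row.
exists (fun y => \row_i ((\row_k (phi_diag 0 k)^-1) 0 i * y 0 i)).
rewrite phiE; split; first exact: smooth_scale_row.
- by move=> x; apply/rowP => i; have := phi_diag_neq0 i; rewrite !mxE => h; exact: mulKf.
- by move=> x; apply/rowP => i; have := phi_diag_neq0 i; rewrite !mxE => h; exact: mulVKf.
Qed.

Lemma jacobian_phi x : 'J (phi c m) x = diag_mx phi_diag.
Proof.
have E : phi c m = mulmxr (diag_mx phi_diag).
  by apply/funext => y; apply/rowP => i; rewrite phiE /= mul_mx_diag !mxE mulrC.
have cphi : continuous (mulmxr (diag_mx phi_diag) : 'rV[R]_(3 + m) -> 'rV[R]_(3 + m)).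
  by rewrite -E phiE => y; have [] := @smooth_scale_row phi_diag [::] y I.
apply/row_matrixP => i; rewrite /jacobian E diff_lin// !rowE mul_rV_lin1.
by [].
Qed.

Lemma pullback_phi x : pullback (phi c m) (g 1 m) x = c ^+ 2 *: g c m x.
Proof.
rewrite /pullback jacobian_phi tr_diag_mx; apply/matrixP => i j.
rewrite mul_mx_diag [LHS]mxE mul_diag_mx mxE [RHS]mxE (g_metN ltr01) (g_metN c0).
have -> : x2 (phi c m x) = c * x2 x by rewrite /x2 phiE !mxE.
rewrite !mxE; move: (x2 x) => X.
case: i j => [[|[|i]] hi] [[|[|j]] hj]; rewrite /= ?expr1n; by ring.
Qed.

End Scaling.
End Metric.

(** * Closed timelike paths *)

Section ClosedTimelikePaths.
Context {R : realType}.
Variable c : R.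
Hypothesis c0 : 0 < c.

Lemma ev2_g3 (x v : 'rV[R]_3) : ev2 (g3 c) x v v =
  - (c * (v 0 i0 + x 0 i2 * v 0 i1)) ^+ 2 + v 0 i1 ^+ 2 + v 0 i2 ^+ 2.
Proof.
rewrite /ev2 /g3 (invmx_frame c0); set M := \matrix_(_, _) _.
have -> : v *m (M *m diag_mx (eps R) *m M^T) *m v^T =
    (v *m M) *m diag_mx (eps R) *m (v *m M)^T by rewrite trmx_mul !mulmxA.
rewrite mulmx_diag_tr sum3 !mxE !sum3 !mxE /=; ring.
Qed.

Lemma timelike_g3P (x v : 'rV[R]_3) : timelike (g3 c) x v <->
  v 0 i1 ^+ 2 + v 0 i2 ^+ 2 < c ^+ 2 * (v 0 i0 + x 0 i2 * v 0 i1) ^+ 2.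
Proof. by rewrite /timelike ev2_g3 -exprMn; split; lra. Qed.

Definition vec3 (f0 f1 f2 : R -> R) (i : 'I_3) : R -> R := nth f0 [:: f0; f1; f2] i.

Lemma smooth_vec3 f0 f1 f2 : smooth f0 -> smooth f1 -> smooth f2 ->
  forall i, smooth (vec3 f0 f1 f2 i).
Proof. by move=> s0 s1 s2 i; case: (I3P i) => ->. Qed.

(** Intermediate value theorem: the time direction at both ends of a timelike path is the same, and
    [s] records it. *)
Lemma constant_sign (a b : R) (u : R -> R) : a < b ->
  {within `[a, b], continuous u} -> (forall t, a <= t <= b -> u t != 0) ->
  exists2 s : R, s * s = 1 & 0 < s * u a /\ 0 < s * u b.
Proof.
move=> ab cu u0.
have ua : u a != 0 by apply: u0; rewrite lexx ltW.
have ub : u b != 0 by apply: u0; rewrite lexx ltW.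
have nz : ~ (Num.min (u a) (u b) <= 0 <= Num.max (u a) (u b)).
  move=> h; have [t] := IVT (ltW ab) cu h.
  by rewrite in_itv /= => /u0/eqP.
have [ha|ha|/eqP] := ltgtP (u a) 0; last by rewrite (negbTE ua).
- exists (-1); first by rewrite mulrNN mulr1.
  rewrite !mulN1r !oppr_gt0; split=> //; rewrite ltNge; apply/negP => hb; apply: nz.
  by rewrite ge_min le_max (ltW ha) hb orbT.
- exists 1; first by rewrite mulr1.
  rewrite !mul1r; split=> //; rewrite ltNge; apply/negP => hb; apply: nz.
  by rewrite ge_min le_max (ltW ha) hb orbT.
Qed.

Lemma smooth_shift (f : R -> R) a : smooth f -> smooth (fun t => f (t - a)).
Proof.
move=> sf; apply: smooth_comp => //.
by apply: smoothB; [exact: smooth_id|exact: smooth_cst].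
Qed.

Lemma derive1_shift (f : R -> R) a t : smooth f ->
  derive1 (fun t => f (t - a)) t = derive1 f (t - a).
Proof. exact: (@derive1n_shift _ f a 1). Qed.

Lemma within_coord N (D : set R) (w : R -> 'rV[R]_N) i :
  {within D, continuous w} -> {within D, continuous (fun t => w t 0 i)}.
Proof. by move=> cw t; exact: (cvg_comp w _ (cw t) (@coord_continuous R 1 N 0 i (w t))). Qed.

(** Only the right end is extended. The added piece starts with the jet of [w] at [b] and finishes
    with the jet at [a], which gives both the gluing and the closing up. *)
Theorem timelike_extension (r : regularity) (a b : R) (w : R -> 'rV[R]_3) :
  reg_le 1 r -> a < b -> timelike_path (g3 c) r a b w ->
  exists (a' b' : R) (w' : R -> 'rV[R]_3),
    [/\ a' <= a, b <= b', forall t, a <= t <= b -> w' t = w t &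
        closed_timelike_path (g3 c) r a' b' w'].
Proof.
move=> r1 ab [wr wtl]; pose F k := derive_within_n `[a, b] k w.
have TF : tower r a b F := Cr_path_tower wr.
have aab : a <= a <= b by rewrite lexx ltW.
have bab : a <= b <= b by rewrite lexx ltW.
pose u t := F 1%N t 0 i0 + F 0%N t 0 i2 * F 1%N t 0 i1.
have tl t : a <= t <= b ->
    F 1%N t 0 i1 ^+ 2 + F 1%N t 0 i2 ^+ 2 < c ^+ 2 * u t ^+ 2.
  by move=> /wtl/timelike_g3P.
have cu : {within `[a, b], continuous u}.
  have cF0 := (TF 0%N).2 (reg_leW r1); have cF1 := (TF 1%N).2 r1.
  have h0 := within_coord (i := i0) cF1; have h1 := within_coord (i := i1) cF1.
  have h2 := within_coord (i := i2) cF0.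
  move=> t; have h := cvgD (h0 t) (cvgM (h2 t) (h1 t)); exact: h.
have u0 t : a <= t <= b -> u t != 0.
  move=> /tl; apply: contraTneq => ->; rewrite expr0n mulr0 -leNgt.
  by rewrite addr_ge0 ?sqr_ge0.
have [sg sg1 [ua ub]] := constant_sign ab cu u0.
(* Beyond order r the numbers [F k b 0 i] are whatever [lim] returns; Borel's lemma accepts any
   sequence. *)
have /choice[p Hp] : forall i : 'I_3, exists f : R -> R,
    smooth f /\ forall k, f^`(k)%classic 0 = F k b 0 i by move=> i; exact: borel.
have /choice[q Hq] : forall i : 'I_3, exists f : R -> R,
    smooth f /\ forall k, f^`(k)%classic 0 = F k a 0 i by move=> i; exact: borel.
have sp i : smooth (p i) := (Hp i).1.
have sq i : smooth (q i) := (Hq i).1.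
have p0E i : p i 0 = F 0%N b 0 i := (Hp i).2 0%N.
have p1E i : derive1 (p i) 0 = F 1%N b 0 i := (Hp i).2 1%N.
have q0E i : q i 0 = F 0%N a 0 i := (Hq i).2 0%N.
have q1E i : derive1 (q i) 0 = F 1%N a 0 i := (Hq i).2 1%N.
have [d1 d10 ptl] : exists2 d, 0 < d & forall x, `|x| <= d ->
    speed2 (p i1) (p i2) x < c ^+ 2 * slope (p i0) (p i1) (p i2) x ^+ 2 /\
    0 < sg * slope (p i0) (p i1) (p i2) x.
  by apply: timelike_nbhs => //; rewrite /speed2 /slope !p1E p0E//; exact: tl.
have [d2 d20 qtl] : exists2 d, 0 < d & forall x, `|x| <= d ->
    speed2 (q i1) (q i2) x < c ^+ 2 * slope (q i0) (q i1) (q i2) x ^+ 2 /\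
    0 < sg * slope (q i0) (q i1) (q i2) x.
  by apply: timelike_nbhs => //; rewrite /speed2 /slope !q1E q0E//; exact: tl.
(* Halved because p must stay timelike on [0, 2 d] and q on [-2 d, 0]. *)
pose d := Num.min d1 d2 / 2.
have m0 : 0 < Num.min d1 d2 by rewrite lt_min d10.
have d0 : 0 < d by rewrite divr_gt0.
have dd1 : 2 * d <= d1 by rewrite /d mulrC divfK// ge_min lexx.
have dd2 : 2 * d <= d2 by rewrite /d mulrC divfK// ge_min lexx orbT.
(* The jet at [a] is to be reached at the end 10 d of the timetable. *)
pose qs i t := q i (t - 10 * d).
have sqs i : smooth (qs i) by exact: smooth_shift.
have [z0 [z1 [z2 [[sz0 sz1 sz2] zp zq ztl]]]] :
    exists z0 z1 z2 : R -> R, [/\ [/\ smooth z0, smooth z1 & smooth z2],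
      forall x, x <= d -> [/\ z0 x = p i0 x, z1 x = p i1 x & z2 x = p i2 x],
      forall x, 9 * d <= x -> [/\ z0 x = qs i0 x, z1 x = qs i1 x & z2 x = qs i2 x] &
      forall x, 0 <= x <= 10 * d ->
        speed2 z1 z2 x < c ^+ 2 * slope z0 z1 z2 x ^+ 2].
  apply: (connecting_loop (sg := sg)) => //.
    by move=> x /andP[x0 x2]; apply: ptl; rewrite ger0_norm//; lra.
  move=> x /andP[x8 x10]; rewrite /speed2 /slope !derive1_shift//.
  by apply: qtl; rewrite ler_norml; lra.
pose z := vec3 z0 z1 z2; have sz := smooth_vec3 sz0 sz1 sz2.
pose zs i t := z i (t - b).
have szs i : smooth (zs i) by exact: smooth_shift.
pose b' := b + 10 * d.
have bb' : b < b' by rewrite /b'; lra.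
have ab' : a < b' by exact: lt_trans bb'.
pose G k t : 'rV[R]_3 := \row_i (zs i)^`(k)%classic t.
have TG : tower r b b' G by exact: smooth_tower_row.
have FG k : F k b = G k b.
  apply/rowP => i; rewrite mxE /zs derive1n_shift// subrr -(Hp i).2.
  have zpi : \forall x \near (0 : R), z i x = p i x.
    apply: filterS (nbhs0_le d0) => x; rewrite ler_norml => /andP[_ xd].
    by have [e0 e1 e2] := zp x xd; case: (I3P i) => ->.
  exact/esym/(nbhs_singleton (near_eq_derive1n k zpi)).
have GF k : G k b' = F k a.
  apply/rowP => i; rewrite mxE /zs derive1n_shift// /b' addrC addKr -(Hq i).2.
  have zqi : \forall x \near (10 * d : R), z i x = qs i x.
    have h : 9 * d < 10 * d by lra.
    apply: filterS (lt_nbhsr h) => x xd.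
    by have [e0 e1 e2] := zq x (ltW xd); case: (I3P i) => ->.
  rewrite (nbhs_singleton (near_eq_derive1n k zqi)) /qs derive1n_shift//.
  by rewrite subrr.
have TH := tower_glue ab bb' TF TG (fun k _ => FG k).
pose w' t := if t <= b then w t else \row_i zs i t.
have w'H t : a <= t <= b' -> w' t = (if t <= b then F 0%N t else G 0%N t) by [].
have DH := tower_derive ab' TH w'H.
exists a, b', w'; split; [exact: lexx|exact: ltW| |].
  by move=> t /andP[_ tb]; rewrite /w' tb.
split; first split.
- exact: tower_Cr_path TH w'H.
- move=> t /[dup] tab' /andP[at_ tb'].
  have := DH 1%N r1 t tab'; rewrite /derive_within_n /= => ->.
  rewrite /w'; have [tb|bt] := leP t b; first by apply: wtl; rewrite at_.
  have dzs i : (zs i)^`(1)%classic t = derive1 (z i) (t - b) by exact: derive1_shift.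
  apply/timelike_g3P; rewrite !mxE !dzs.
  by apply: ztl; move: tb' bt; rewrite /b'; lra.
- move=> k kr; rewrite DH//; last by rewrite lexx ltW.
  rewrite DH//; last by rewrite lexx ltW.
  by rewrite (ltW ab) leNgt bb' /= GF.
Qed.

(** * Adding the euclidean factor *)

Section Product.
Variables (m : nat).

Lemma timelike_row_mx (x v : 'rV[R]_3) (y : 'rV[R]_m) :
  timelike (g c m) (row_mx x y) (row_mx v 0) <-> timelike (g3 c) x v.
Proof.
rewrite /timelike ev2_g// ev2_g3 /x2 !row_mxEl big1 ?addr0// => k _.
by rewrite row_mxEr mxE expr0n.
Qed.

Lemma tower_row_mx r a b (F : nat -> R -> 'rV[R]_3) (y : 'rV[R]_m) :
  tower r a b F ->
  tower r a b (fun k t => row_mx (F k t) (if k == 0%N then y else 0)).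
Proof.
move=> TF k; split=> [kr t tab|kr].
  apply: cvg_row => i; case: (split_ordP i) => j ->.
    rewrite row_mxEl (_ : (fun s => _) =
        fun s => ((s - t)^-1 *: (F k s - F k t)) 0 j); last first.
      by apply/funext => s; rewrite !mxE !(unsplitK (inl _)).
    have /cvg_rowP := (TF k).1 kr t tab; exact.
  rewrite row_mxEr (_ : (fun s => _) = cst 0); last first.
    by apply/funext => s; rewrite !mxE !(unsplitK (inr _)) subrr mulr0.
  by rewrite mxE; exact: cvg_cst.
move=> t; apply: cvg_row => i; case: (split_ordP i) => j ->.
  have h := within_coord (i := j) ((TF k).2 kr).
  rewrite /from_subspace row_mxEl (_ : (fun s => _) = fun s => F k s 0 j); first exact: h.
  by apply/funext => s; rewrite row_mxEl.
rewrite /from_subspace row_mxEr (_ : (fun s => _) = cst ((if k == 0%N then y else 0) 0 j)).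
  exact: cvg_cst.
by apply/funext => s; rewrite row_mxEr.
Qed.

(** The seed is a segment of the x0-line through p, which has slope 1 and planar speed 0; it is
    closed up in dimension 3 with the euclidean coordinates frozen. *)
Theorem closed_timelike_through (r : regularity) (p : 'rV[R]_(3 + m)) :
  reg_le 1 r ->
  exists (a b : R) (w : R -> 'rV[R]_(3 + m)),
    [/\ a < b, closed_timelike_path (g c m) r a b w &
        exists2 t, a <= t <= b & w t = p].
Proof.
move=> r1; pose q := lsubmx p.
pose z := vec3 (fun t : R => q 0 i0 + t) (cst (q 0 i1)) (cst (q 0 i2)).
have sz i : smooth (z i).
  apply: smooth_vec3; [|exact: smooth_cst..].
  by apply: smoothD; [exact: smooth_cst|exact: smooth_id].
pose w t : 'rV[R]_3 := \row_i z i t.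
have Tw := smooth_tower_row r 0 1 sz.
have wE t : 0 <= t <= 1 -> w t = \row_i (z i)^`(0)%classic t by [].
have wtl : timelike_path (g3 c) r 0 1 w.
  split; first exact: tower_Cr_path ltr01 Tw wE.
  move=> t t01; have := tower_derive ltr01 Tw wE r1 t01.
  rewrite /derive_within_n /= => ->; apply/timelike_g3P; rewrite !mxE /z /vec3 /=.
  rewrite !derive1_cst derive1_smoothD; [|exact: smooth_cst|exact: smooth_id].
  rewrite derive1_cst derive1_id !expr0n /= mulr0 !addr0 add0r expr1n mulr1.
  by rewrite exprn_gt0.
have [a [b [w' [a0 b1 ww' [[w'r w'tl] w'c]]]]] := timelike_extension r1 ltr01 wtl.
have ab : a < b by lra.
pose W t := row_mx (w' t) (rsubmx p).
have TW := tower_row_mx (rsubmx p) (Cr_path_tower w'r).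
have WE t : a <= t <= b -> W t = row_mx (derive_within_n `[a, b] 0 w' t) (rsubmx p) by [].
have DW := tower_derive ab TW WE.
exists a, b, W; split=> //.
- split; first split.
  + exact: tower_Cr_path ab TW WE.
  + move=> t tab; have := DW 1%N r1 t tab; rewrite {1}/derive_within_n /= => ->.
    by apply/timelike_row_mx; exact: w'tl.
  + by move=> k kr; rewrite !DW ?lexx ?ltW//= w'c.
- exists 0; first by apply/andP; split; lra.
  rewrite /W ww' ?lexx ?ler01// -[RHS]hsubmxK; congr row_mx.
  apply/rowP => i; rewrite mxE /z; case: (I3P i) => -> //=.
  by rewrite /vec3 /= addr0.
Qed.

End Product.

End ClosedTimelikePaths.

(** * Geodesics *)

Section Geodesics.
Context {R : realType}.

Section Calculus.
Implicit Types (f g : R -> R) (t : R).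

Lemma derD f g t a b : is_derive t (1 : R) f a -> is_derive t (1 : R) g b ->
  is_derive t (1 : R) (fun s => f s + g s) (a + b).
Proof. by move=> df dg; exact: is_deriveD. Qed.

Lemma derN f t a : is_derive t (1 : R) f a -> is_derive t (1 : R) (fun s => - f s) (- a).
Proof. by move=> df; exact: is_deriveN. Qed.

Lemma derB f g t a b : is_derive t (1 : R) f a -> is_derive t (1 : R) g b ->
  is_derive t (1 : R) (fun s => f s - g s) (a - b).
Proof. by move=> df dg; exact: is_deriveB. Qed.

Lemma derM f g t a b : is_derive t (1 : R) f a -> is_derive t (1 : R) g b ->
  is_derive t (1 : R) (fun s => f s * g s) (a * g t + f t * b).
Proof.
move=> df dg; apply: (is_derive_eq (is_deriveM df dg)).
by rewrite addrC; congr (_ + _); exact: mulrC.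
Qed.

Lemma derC k t : is_derive t (1 : R) (fun=> k : R) 0.
Proof. exact: is_derive_cst. Qed.

Lemma derZ k f t a : is_derive t (1 : R) f a -> is_derive t (1 : R) (fun s => k * f s) (k * a).
Proof. by move=> df; exact: (is_deriveZ k df). Qed.

Lemma derI t : is_derive t (1 : R) (fun s : R => s) 1.
Proof. exact: is_derive_id. Qed.

Lemma der_sin f t a : is_derive t (1 : R) f a ->
  is_derive t (1 : R) (fun s => sin (f s)) (a * cos (f t)).
Proof. by rewrite mulrC; exact: (is_derive1_comp (is_derive_sin _)). Qed.

Lemma der_cos f t a : is_derive t (1 : R) f a ->
  is_derive t (1 : R) (fun s => cos (f s)) (- (a * sin (f t))).
Proof. by rewrite mulrC -mulNr; exact: (is_derive1_comp (is_derive_cos _)). Qed.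

Lemma constant_on_interval (J : set R) f s t : is_interval J ->
  (forall r, J r -> is_derive r (1 : R) f 0) -> J s -> J t -> f s = f t.
Proof.
move=> iJ df; wlog st : s t / s <= t.
  by move=> H Js Jt; have [/H|/ltW/H] := leP s t; [|move=> E; apply/esym]; auto.
move=> Js Jt; have JJ r : s <= r <= t -> J r by exact: iJ.
have [r||r _] := @MVT_segment _ f (fun=> 0) s t st.
- by rewrite in_itv /= => /andP[sr rt]; apply/df/JJ; rewrite !ltW.
- apply: derivable_within_continuous => r; rewrite in_itv /= => /JJ/df.
  by case.
by rewrite mul0r => /eqP; rewrite subr_eq0 => /eqP.
Qed.

Lemma eq_on_interval (J : set R) (f f' k : R -> R) t0 : is_interval J -> J t0 ->
  (forall t, J t -> is_derive t (1 : R) f (k t)) ->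
  (forall t, J t -> is_derive t (1 : R) f' (k t)) -> f t0 = f' t0 ->
  forall t, J t -> f t = f' t.
Proof.
move=> iJ Jt0 df df' e t Jt; apply/eqP; rewrite -subr_eq0; apply/eqP.
have -> : f t - f' t = f t0 - f' t0; last by rewrite e subrr.
apply: (constant_on_interval (f := fun s => f s - f' s) iJ) => // r Jr.
by apply: (is_derive_eq (derB (df r Jr) (df' r Jr))); rewrite subrr.
Qed.

(* The squared distance of two solutions of the rotation equation is constant. *)
Lemma rotation_unique (J : set R) (w t0 : R) (a1 a2 b1 b2 : R -> R) :
  is_interval J -> J t0 ->
  (forall t, J t -> is_derive t (1 : R) a1 (w * a2 t)) ->
  (forall t, J t -> is_derive t (1 : R) a2 (- (w * a1 t))) ->
  (forall t, J t -> is_derive t (1 : R) b1 (w * b2 t)) ->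
  (forall t, J t -> is_derive t (1 : R) b2 (- (w * b1 t))) ->
  a1 t0 = b1 t0 -> a2 t0 = b2 t0 -> forall t, J t -> a1 t = b1 t /\ a2 t = b2 t.
Proof.
move=> iJ Jt0 da1 da2 db1 db2 e1 e2 t Jt.
pose d1 s := a1 s - b1 s; pose d2 s := a2 s - b2 s.
have dd1 s : J s -> is_derive s (1 : R) d1 (w * d2 s).
  by move=> Js; apply: (is_derive_eq (derB (da1 s Js) (db1 s Js))); rewrite mulrBr.
have dd2 s : J s -> is_derive s (1 : R) d2 (- (w * d1 s)).
  by move=> Js; apply: (is_derive_eq (derB (da2 s Js) (db2 s Js))); rewrite /d1; ring.
have : d1 t * d1 t + d2 t * d2 t = 0.
  transitivity (d1 t0 * d1 t0 + d2 t0 * d2 t0).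
    apply: (constant_on_interval (f := fun s => d1 s * d1 s + d2 s * d2 s) iJ) => // s Js.
    apply: (is_derive_eq (derD (derM (dd1 s Js) (dd1 s Js)) (derM (dd2 s Js) (dd2 s Js)))).
    by ring.
  by rewrite /d1 /d2 e1 e2 !subrr mulr0 addr0.
move/eqP; rewrite -!expr2 paddr_eq0 ?sqr_ge0// !sqrf_eq0 /d1 /d2 !subr_eq0.
by move=> /andP[/eqP -> /eqP ->].
Qed.

End Calculus.

(** * The geodesic equation and its solutions *)

Section Equations.
Variables (c : R) (m : nat).
Hypothesis c0 : 0 < c.
Let n0 := lshift m i0.
Let n1 := lshift m i1.
Let n2 := lshift m i2.

(** The quadratic form of the Christoffel symbols, so that geodesics satisfy x'' = - [accel]. *)
Definition accel (k : nat) (X v0 v1 v2 : R) : R :=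
  match k with
  | 0 => c ^+ 2 * X * v0 * v2 + (1 + c ^+ 2 * X ^+ 2) * v1 * v2
  | 1 => - (c ^+ 2 * v2 * (v0 + X * v1))
  | 2 => c ^+ 2 * v1 * (v0 + X * v1)
  | _ => 0
  end.

Lemma christoffel_accel (k : 'I_(3 + m)) (x v : 'rV[R]_(3 + m)) :
  \sum_(i < 3 + m) \sum_(j < 3 + m) christoffel (g c m) k i j x * v 0 i * v 0 j =
  accel k (x2 x) (v 0 n0) (v 0 n1) (v 0 n2).
Proof.
transitivity (\sum_(i < 3 + m) \sum_(j < 3 + m) chrN c k i j (x2 x) * v 0 i * v 0 j).
  by apply: eq_bigr => i _; apply: eq_bigr => j _; rewrite christoffel_chrN.
move: (x2 x) => X; rewrite sum_split3 [X in _ + X]big1 => [|i _]; last first.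
  rewrite big1 // => j _.
  by case: k => [[|[|[|k]]] hk]; rewrite /= !mul0r.
have tail (i : 'I_3) : \sum_(l < m) chrN c k (lshift m i) (rshift 3 l) X *
    v 0 (lshift m i) * v 0 (rshift 3 l) = 0.
  rewrite big1 // => l _.
  by case: k => [[|[|[|k]]] hk]; case: (I3P i) => ->; rewrite /= !mul0r.
rewrite !sum_split3 !tail; rewrite -/n0 -/n1 -/n2.
by case: k {tail} => [[|[|[|k]]] hk] /=; field.
Qed.

Lemma derive1_row (gamma : R -> 'rV[R]_(3 + m)) t i : derivable gamma t 1 ->
  is_derive t (1 : R) (fun s => gamma s 0 i) (derive1 gamma t 0 i).
Proof.
move=> dg; have /derivable_mxP dgi := dg; apply: DeriveDef; first exact: dgi.
by rewrite derive1E derive_mx// mxE.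
Qed.

Lemma geodesic_components (J : set R) gamma t : is_geodesic (g c m) J gamma -> J t ->
  (forall i, is_derive t (1 : R) (fun s => gamma s 0 i) (derive1 gamma t 0 i)) /\
  (forall i, is_derive t (1 : R) (fun s => derive1 gamma s 0 i)
     (- accel i (gamma t 0 n2) (derive1 gamma t 0 n0) (derive1 gamma t 0 n1)
        (derive1 gamma t 0 n2))).
Proof.
move=> [sg ge] Jt; split=> i.
  by apply: derive1_row; have [+ _] := sg [::] t Jt; apply.
have d2 : derivable (derive1 gamma) t 1.
  rewrite (_ : derive1 gamma = 'D_1 gamma); last by apply/funext => s; rewrite derive1E.
  by have [+ _] := sg [:: 1] t Jt; apply.
apply: (is_derive_eq (derive1_row i d2)).
have := ge t Jt i; rewrite christoffel_accel -/(x2 _) => /eqP.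
by rewrite addr_eq0 => /eqP ->.
Qed.

Lemma derive1_rowE (x v : 'I_(3 + m) -> R -> R) t :
  (forall i, is_derive t (1 : R) (x i) (v i t)) ->
  derive1 (fun t => \row_i x i t : 'rV[R]_(3 + m)) t = \row_i v i t.
Proof.
have rowE i : (fun s => (\row_i x i s : 'rV[R]_(3 + m)) 0 i) = x i.
  by apply/funext => s; rewrite mxE.
move=> dx; rewrite derive1E derive_mx.
  by apply/rowP => i; rewrite !mxE rowE; case: (dx i).
by apply/derivable_mxP => k i; rewrite ord1 rowE; case: (dx i).
Qed.

Lemma is_geodesic_row (J : set R) (x v a : 'I_(3 + m) -> R -> R) :
  (forall i, smooth (x i)) ->
  (forall i t, is_derive t (1 : R) (x i) (v i t)) ->
  (forall i t, is_derive t (1 : R) (v i) (a i t)) ->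
  (forall i t, a i t + accel i (x n2 t) (v n0 t) (v n1 t) (v n2 t) = 0) ->
  is_geodesic (g c m) J (fun t => \row_i x i t).
Proof.
move=> sx dx dv E; split.
  apply: smooth_on_row => i; rewrite (_ : (fun y => _) = x i)//.
  by apply/funext => y; rewrite mxE.
move=> t _ k; rewrite (_ : derive1 (fun t => \row_i x i t) = fun t => \row_i v i t); last first.
  by apply/funext => s; exact: derive1_rowE.
by rewrite (derive1_rowE (v := a))// christoffel_accel /x2 !mxE.
Qed.

Section Conserved.
Variables (J : set R) (gamma : R -> 'rV[R]_(3 + m)).
Hypotheses (iJ : is_interval J) (gJ : is_geodesic (g c m) J gamma).
Let x i t := gamma t 0 i.
Let v i t := derive1 gamma t 0 i.

Let dx t i : J t -> is_derive t (1 : R) (x i) (v i t).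
Proof. by move=> Jt; exact: (geodesic_components gJ Jt).1. Qed.

Let dv t i : J t -> is_derive t (1 : R) (v i) (- accel i (x n2 t) (v n0 t) (v n1 t) (v n2 t)).
Proof. by move=> Jt; exact: (geodesic_components gJ Jt).2. Qed.

Let u t := v n0 t + x n2 t * v n1 t.

(** The metric does not depend on x0, so the coordinate field of x0 is Killing; - c^2 u is its inner
    product with the velocity. *)
Lemma geodesic_momentum s t : J s -> J t -> u s = u t.
Proof.
apply: (constant_on_interval iJ) => r Jr.
apply: (is_derive_eq (derD (dv n0 Jr) (derM (dx n2 Jr) (dv n1 Jr)))).
by rewrite /=; ring.
Qed.

(** Freezing u at its value at [t0] makes the planar equations linear with constant coefficients. *)
Lemma geodesic_velocity t0 i t : J t0 -> J t -> is_derive t (1 : R) (v i)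
  match i : nat with
  | 1 => c ^+ 2 * u t0 * v n2 t | 2 => - (c ^+ 2 * u t0 * v n1 t)
  | 0 => - (v n2 t * v n1 t + x n2 t * (c ^+ 2 * u t0 * v n2 t)) | _ => 0 end.
Proof.
move=> Jt0 Jt; apply: (is_derive_eq (dv i Jt)).
rewrite (geodesic_momentum Jt0 Jt) /u.
by case: i => [[|[|[|i]]] hi] /=; ring.
Qed.

End Conserved.

Lemma rotation_rate w t : is_derive t (1 : R) (fun s => cos (w * s)) (- (w * sin (w * t))) /\
  is_derive t (1 : R) (fun s => sin (w * s)) (w * cos (w * t)).
Proof.
have h : is_derive t (1 : R) (fun s => w * s) w by have := derZ w (derI t); rewrite mulr1.
by split; [exact: der_cos|exact: der_sin].
Qed.

(** The system is triangular: planar velocities agree by [rotation_unique], hence x2, hence x0'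
    through the momentum, and the positions follow by integration. *)
Lemma geodesic_unique (J : set R) gamma delta t0 : is_interval J ->
  is_geodesic (g c m) J gamma -> is_geodesic (g c m) J delta -> J t0 ->
  gamma t0 = delta t0 -> derive1 gamma t0 = derive1 delta t0 ->
  forall t, J t -> gamma t = delta t.
Proof.
move=> iJ gg gd Jt0 e0 e1.
have velg i t (Jt : J t) := geodesic_velocity iJ gg i Jt0 Jt.
have veld i t (Jt : J t) := geodesic_velocity iJ gd i Jt0 Jt.
have rot := rotation_unique iJ Jt0 (velg n1) (velg n2).
(* Equal initial data give equal momenta, so both planar velocities rotate at the same rate. *)
rewrite e0 e1 in rot.
have {}rot := rot _ _ (veld n1) (veld n2) erefl erefl.
have posg i t (Jt : J t) := (geodesic_components gg Jt).1 i.
have posd i t (Jt : J t) := (geodesic_components gd Jt).1 i.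
have x_eq i : (forall t, J t -> derive1 gamma t 0 i = derive1 delta t 0 i) ->
    forall t, J t -> gamma t 0 i = delta t 0 i.
  move=> vE; apply: (eq_on_interval iJ Jt0 (posg i)); last by rewrite e0.
  by move=> t Jt; rewrite vE//; exact: posd.
have x2E := x_eq n2 (fun t Jt => (rot t Jt).2).
have v0E t : J t -> derive1 gamma t 0 n0 = derive1 delta t 0 n0.
  move=> Jt; have hg := geodesic_momentum iJ gg Jt0 Jt.
  have hd := geodesic_momentum iJ gd Jt0 Jt.
  have E := etrans (esym hg) (etrans (congr2 (fun y v : 'rV[R]_(3 + m) =>
    v 0 n0 + y 0 n2 * v 0 n1) e0 e1) hd).
  by move: E; rewrite (x2E t Jt) (rot t Jt).1; exact: addIr.
move=> t Jt; apply/rowP => i; move: t Jt; apply: x_eq.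
case: (split_ordP i) => [j|k] ->.
  by case: (I3P j) => -> t Jt; [exact: v0E|exact: (rot t Jt).1|exact: (rot t Jt).2].
apply: (eq_on_interval iJ Jt0 (velg (rshift 3 k)) (veld (rshift 3 k))).
by rewrite e1.
Qed.

Lemma rotation_sum w A B t :
  is_derive t (1 : R) (fun s => A * cos (w * s) + B * sin (w * s))
    (w * (B * cos (w * t) - A * sin (w * t))) /\
  is_derive t (1 : R) (fun s => B * cos (w * s) - A * sin (w * s))
    (- (w * (A * cos (w * t) + B * sin (w * t)))).
Proof.
have [dc ds] := rotation_rate w t; split.
  by apply: (is_derive_eq (derD (derZ A dc) (derZ B ds))); ring.
by apply: (is_derive_eq (derB (derZ B dc) (derZ A ds))); ring.
Qed.

(** Closed formulas for the solution with planar velocity (A, B) at time 0, global and smooth by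
    construction. The line w = 0 is separate since the circle has its centre and radius divided by
    w. *)
Lemma helix (w A B U y0 y1 y2 : R) : exists f0 f1 f2 : R -> R,
  [/\ [/\ smooth f0, smooth f1 & smooth f2], [/\ f0 0 = y0, f1 0 = y1 & f2 0 = y2],
    forall t, is_derive t (1 : R) f1 (A * cos (w * t) + B * sin (w * t)),
    forall t, is_derive t (1 : R) f2 (B * cos (w * t) - A * sin (w * t)) &
    forall t, is_derive t (1 : R) f0 (U - f2 t * (A * cos (w * t) + B * sin (w * t)))].
Proof.
have sid := @smooth_id R; have sc k := @smooth_cst R R k.
have [->|w0] := eqVneq w 0.
  exists (fun t => y0 + (U * t - A * (y2 * t + B * (t * t / 2)))),
    (fun t => y1 + A * t), (fun t => y2 + B * t); split.
  - have sZ k : smooth (fun t : R => k * t) by exact: smoothZ.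
    split; [|exact: (smoothD (sc _) (sZ _))|exact: (smoothD (sc _) (sZ _))].
    have stt := smoothM (smoothM sid sid) (sc 2^-1).
    exact: (smoothD (sc y0) (smoothB (sZ U) (smoothZ A (smoothD (sZ y2) (smoothZ B stt))))).
  - by rewrite !(mulr0, mul0r, addr0, subr0).
  - move=> t; apply: (is_derive_eq (derD (derC y1 t) (derZ A (derI t)))).
    by rewrite mul0r cos0 sin0; ring.
  - move=> t; apply: (is_derive_eq (derD (derC y2 t) (derZ B (derI t)))).
    by rewrite mul0r cos0 sin0; ring.
  - move=> t; apply: (is_derive_eq (derD (derC y0 t) (derB (derZ U (derI t)) (derZ A
      (derD (derZ y2 (derI t)) (derZ B (derM (derM (derI t) (derI t)) (derC _ t)))))))).
    by rewrite mul0r cos0 sin0; field.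
pose D1 t := A * cos (w * t) + B * sin (w * t).
pose D2 t := B * cos (w * t) - A * sin (w * t).
have sw : smooth (fun t : R => w * t) by exact: smoothZ.
have ssin : smooth (fun t : R => sin (w * t)) by apply: smooth_comp => //; exact: smooth_sin.
have scos : smooth (fun t : R => cos (w * t)) by apply: smooth_comp => //; exact: smooth_cos.
have sD1 : smooth D1 by apply: smoothD; exact: smoothZ.
have sD2 : smooth D2 by apply: smoothB; exact: smoothZ.
have dD1 t : is_derive t (1 : R) D1 (w * D2 t) := (rotation_sum w A B t).1.
have dD2 t : is_derive t (1 : R) D2 (- (w * D1 t)) := (rotation_sum w A B t).2.
have E t : D1 t ^+ 2 + D2 t ^+ 2 = A ^+ 2 + B ^+ 2.
  transitivity ((A ^+ 2 + B ^+ 2) * (cos (w * t) ^+ 2 + sin (w * t) ^+ 2)).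
    by rewrite /D1 /D2; ring.
  by rewrite cos2Dsin2 mulr1.
have D10 : D1 0 = A by rewrite /D1 mulr0 cos0 sin0; ring.
have D20 : D2 0 = B by rewrite /D2 mulr0 cos0 sin0; ring.
pose k1 := y1 + w^-1 * B; pose k2 := y2 - w^-1 * A.
pose f1 t := k1 - w^-1 * D2 t; pose f2 t := k2 + w^-1 * D1 t.
have df1 t : is_derive t (1 : R) f1 (D1 t).
  by apply: (is_derive_eq (derB (derC k1 t) (derZ w^-1 (dD2 t)))); field.
have df2 t : is_derive t (1 : R) f2 (D2 t).
  by apply: (is_derive_eq (derD (derC k2 t) (derZ w^-1 (dD1 t)))); field.
(* 2 f2 f1' = h', because f1' - w f2 and f2' + w f1 are constant. *)
pose h t := f1 t * f2 t + ((A ^+ 2 + B ^+ 2) / w * t + (k2 * f1 t - k1 * f2 t)).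
have sf1 : smooth f1 := smoothB (sc k1) (smoothZ w^-1 sD2).
have sf2 : smooth f2 := smoothD (sc k2) (smoothZ w^-1 sD1).
have sh : smooth h := smoothD (smoothM sf1 sf2)
  (smoothD (smoothZ _ sid) (smoothB (smoothZ k2 sf1) (smoothZ k1 sf2))).
exists (fun t => (y0 + 2^-1 * h 0) + (U * t - 2^-1 * h t)), f1, f2; split=> //.
- split; [|exact: sf1|exact: sf2].
  exact: (smoothD (sc _) (smoothB (smoothZ U sid) (smoothZ 2^-1 sh))).
- split; first by ring.
    by rewrite /f1 D20 /k1; ring.
  by rewrite /f2 D10 /k2; ring.
- move=> t; rewrite -/(D1 t).
  have dh := derD (derM (df1 t) (df2 t)) (derD (derZ ((A ^+ 2 + B ^+ 2) / w) (derI t))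
    (derB (derZ k2 (df1 t)) (derZ k1 (df2 t)))).
  apply: (is_derive_eq (derD (derC (y0 + 2^-1 * h 0) t)
    (derB (derZ U (derI t)) (derZ 2^-1 dh)))).
  by rewrite -(E t) /f1 /f2; field.
Qed.

Definition ext3 (T : Type) (f0 f1 f2 : T) (f : 'I_(3 + m) -> T) (i : 'I_(3 + m)) : T :=
  match i : nat with 0 => f0 | 1 => f1 | 2 => f2 | _ => f i end.

Lemma is_geodesic_sub (J K : set R) gamma : K `<=` J ->
  is_geodesic (g c m) J gamma -> is_geodesic (g c m) K gamma.
Proof. by move=> KJ [sg E]; split=> [vs t /KJ|t /KJ]; [exact: sg|exact: E]. Qed.

Lemma geodesic_exists (y v : 'rV[R]_(3 + m)) t0 : exists delta : R -> 'rV[R]_(3 + m),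
  [/\ is_geodesic (g c m) setT delta, delta t0 = y & derive1 delta t0 = v].
Proof.
pose A := v 0 n1; pose B := v 0 n2.
pose U := v 0 n0 + y 0 n2 * v 0 n1; pose w := c ^+ 2 * U.
have [f0 [f1 [f2 [[s0 s1 s2] [e0 e1 e2] d1 d2 d0]]]] :=
  helix w A B U (y 0 n0) (y 0 n1) (y 0 n2).
have dsh (f f' : R -> R) : (forall t, is_derive t (1 : R) f (f' t)) ->
    forall t, is_derive t (1 : R) (fun s => f (s - t0)) (f' (t - t0)).
  move=> df t; have ds : is_derive t (1 : R) (fun s : R => s - t0) 1.
    by have := derB (derI t) (derC t0 t); rewrite subr0.
  have := @is_derive1_comp _ f (fun s : R => s - t0) t _ _ (df (t - t0)) ds.
  by rewrite mulr1.
pose D1 s := A * cos (w * s) + B * sin (w * s).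
pose D2 s := B * cos (w * s) - A * sin (w * s).
have dD1 t : is_derive t (1 : R) D1 (w * D2 t) := (rotation_sum w A B t).1.
have dD2 t : is_derive t (1 : R) D2 (- (w * D1 t)) := (rotation_sum w A B t).2.
pose x := ext3 f0 f1 f2 (fun i s => y 0 i + v 0 i * s).
pose x' := ext3 (fun s => U - f2 s * D1 s) D1 D2 (fun i => cst (v 0 i)).
pose x'' := ext3 (fun s => - (D2 s * D1 s + f2 s * (w * D2 s))) (fun s => w * D2 s)
  (fun s => - (w * D1 s)) (fun i => cst 0).
have dx i t : is_derive t (1 : R) (x i) (x' i t).
  rewrite /x /x'; case: (split_ordP i) => [j|k] ->; last first.
    apply: (is_derive_eq (derD (derC (y 0 (rshift 3 k)) t) (derZ (v 0 (rshift 3 k)) (derI t)))).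
    by rewrite /ext3 /=; ring.
  by case: (I3P j) => -> /=; [exact: d0|exact: d1|exact: d2].
have dx' i t : is_derive t (1 : R) (x' i) (x'' i t).
  rewrite /x' /x''; case: (split_ordP i) => [j|k] ->; last exact: derC.
  case: (I3P j) => ->; [|exact: dD1|exact: dD2].
  apply: (is_derive_eq (derB (derC U t) (derM (d2 t) (dD1 t)))).
  by rewrite /ext3 /= -/(D1 t) -/(D2 t); ring.
have sx i : smooth (x i).
  rewrite /x; case: (split_ordP i) => [j|k] ->; last first.
    exact: (smoothD (smooth_cst _) (smoothZ _ (smooth_id))).
  by case: (I3P j) => ->.
have delta_geo : is_geodesic (g c m) setT (fun t => \row_i x i (t - t0)).
  apply: (@is_geodesic_row _ (fun i t => x i (t - t0)) (fun i t => x' i (t - t0))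
    (fun i t => x'' i (t - t0))).
  - by move=> i; exact: smooth_shift.
  - move=> i t; move: (t - t0) => s; rewrite /x' /x'' /x /w /ext3 /=.
    by case: i => [[|[|[|i]]] hi] /=; ring.
exists (fun t => \row_i x i (t - t0)); split=> //.
  apply/rowP => i; rewrite mxE subrr /x; case: (split_ordP i) => [j|k] ->.
    by case: (I3P j) => ->.
  by rewrite /ext3 /= mulr0 addr0.
rewrite (derive1_rowE (v := fun i t => x' i (t - t0)))//.
apply/rowP => i; rewrite mxE subrr /x'; case: (split_ordP i) => [j|k] -> //.
case: (I3P j) => ->; rewrite /ext3 /= /D1 /D2 mulr0 cos0 sin0 mulr1 mulr0 ?addr0 ?subr0//.
by rewrite e2 /U /A addrK.
Qed.

(** A global geodesic with the position and velocity of [gamma] at one time in J extends it by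
    uniqueness on J; if J is empty, any global geodesic does. *)
Theorem geodesically_complete_g : geodesically_complete (g c m).
Proof.
move=> J gamma iJ _ gJ; have [[t0 Jt0]|nJ] := pselect (exists t, J t).
  have [delta [gd e0 e1]] := geodesic_exists (gamma t0) (derive1 gamma t0) t0.
  have gdJ := is_geodesic_sub (@subsetT _ J) gd.
  by exists delta; split=> // t Jt; exact: (geodesic_unique iJ gdJ gJ Jt0 e0 e1).
have [delta [gd _ _]] := geodesic_exists 0 0 0.
by exists delta; split=> // t Jt; case: nJ; exists t.
Qed.

(* For a periodic geodesic the invariants below force |h'|^2 = 2 (c u)^2, where h is
   the planar part and u the constant momentum, whereas a causal velocity satisfies
   |h'|^2 <= (c u)^2. *)
Theorem no_closed_causal_geodesic : ~ exists gamma : R -> 'rV[R]_(3 + m),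
  closed_geodesic (g c m) gamma /\ causal_curve (g c m) gamma.
Proof.
move=> [gamma [[gg [T T0 per] _] caus]].
have iT : is_interval (setT : set R) by [].
pose x i t := gamma t 0 i; pose v i t := derive1 gamma t 0 i.
have dx i t : is_derive t (1 : R) (x i) (v i t).
  exact: (geodesic_components gg (I : setT t)).1.
pose U := v n0 0 + x n2 0 * v n1 0; pose w := c ^+ 2 * U.
have uE t : v n0 t + x n2 t * v n1 t = U := geodesic_momentum iT gg (I : setT t) (I : setT 0).
have dv1 t : is_derive t (1 : R) (v n1) (w * v n2 t).
  exact: (geodesic_velocity iT gg n1 (I : setT 0) (I : setT t)).
have dv2 t : is_derive t (1 : R) (v n2) (- (w * v n1 t)).
  exact: (geodesic_velocity iT gg n2 (I : setT 0) (I : setT t)).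
have const (f : R -> R) : (forall t, is_derive t (1 : R) f 0) -> forall t, f t = f 0.
  by move=> df t; exact: (constant_on_interval iT (fun r _ => df r)).
pose a1 := v n1 0 - w * x n2 0; pose a2 := v n2 0 + w * x n1 0.
pose E := v n1 0 * v n1 0 + v n2 0 * v n2 0.
have a1E : forall t, v n1 t - w * x n2 t = a1.
  apply: (const (fun t => v n1 t - w * x n2 t)) => t.
  by apply: (is_derive_eq (derB (dv1 t) (derZ w (dx n2 t)))); rewrite subrr.
have a2E : forall t, v n2 t + w * x n1 t = a2.
  apply: (const (fun t => v n2 t + w * x n1 t)) => t.
  by apply: (is_derive_eq (derD (dv2 t) (derZ w (dx n1 t)))); rewrite addNr.
have EE : forall t, v n1 t * v n1 t + v n2 t * v n2 t = E.
  apply: (const (fun t => v n1 t * v n1 t + v n2 t * v n2 t)) => t.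
  apply: (is_derive_eq (derD (derM (dv1 t) (dv1 t)) (derM (dv2 t) (dv2 t)))).
  by ring.
(* A first integral got by integrating 2 w x0' = 2 w U - 2 w x2 x1', the last product being
   rewritten through [a1], [a2] and [E]. All its terms are periodic except those in t, so one period
   gives T (E - 2 w U) = 0. *)
pose F t := 2 * w * (x n0 t - U * t) + w * (x n1 t * x n2 t) + (E * t -
  (a1 * x n1 t + a2 * x n2 t)).
have FT : F T = F 0.
  apply: (const F) => t.
  apply: (is_derive_eq (derD (derD (derZ (2 * w) (derB (dx n0 t) (derZ U (derI t))))
    (derZ w (derM (dx n1 t) (dx n2 t))))
    (derB (derZ E (derI t)) (derD (derZ a1 (dx n1 t)) (derZ a2 (dx n2 t)))))).
  by rewrite -(uE t) -(EE t) -(a1E t) -(a2E t); ring.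
have xT i : x i T = x i 0 by rewrite /x -(per 0) add0r.
have EU : E = 2 * c ^+ 2 * U ^+ 2.
  have : T * (E - 2 * w * U) = F T - F 0 by rewrite /F !xT; ring.
  rewrite FT subrr => /eqP; rewrite mulf_eq0 gt_eqF//= subr_eq0 => /eqP ->.
  by rewrite /w; ring.
pose S := \sum_(k < m) v (rshift 3 k) 0 ^+ 2.
have S0 : 0 <= S by apply: sumr_ge0 => k _; exact: sqr_ge0.
have qE : ev2 (g c m) (gamma 0) (derive1 gamma 0) (derive1 gamma 0) = c ^+ 2 * U ^+ 2 + S.
  rewrite ev2_g// -/(v n0 0) -/(v n1 0) -/(v n2 0) -/S /x2 -/(x n2 0) -/U.
  have -> : v n2 0 ^+ 2 = E - v n1 0 ^+ 2 by rewrite /E; ring.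
  by rewrite EU; ring.
have q0 : 0 <= c ^+ 2 * U ^+ 2 by rewrite mulr_ge0 ?sqr_ge0.
(* The norm is nonnegative, which excludes timelike. If it is 0 then U, E and the euclidean velocity
   vanish, hence the whole velocity, which excludes lightlike. *)
case: (caus 0); rewrite /timelike /lightlike qE; first by rewrite ltNge addr_ge0.
move=> [/eqP]; rewrite paddr_eq0// mulf_eq0 !sqrf_eq0 gt_eqF//= => /andP[/eqP U0 SE].
apply/negP; rewrite negbK; apply/eqP/rowP => i; rewrite mxE -/(v i 0).
have /eqP : E = 0 by rewrite EU U0 expr0n mulr0.
rewrite /E -!expr2 paddr_eq0 ?sqr_ge0// !sqrf_eq0 => /andP[/eqP v1 /eqP v2].
case: (split_ordP i) => [j|k] ->; last first.
  move: SE; rewrite /S psumr_eq0 => [/allP/(_ k)|l _]; last exact: sqr_ge0.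
  by rewrite mem_index_enum => /(_ isT); rewrite sqrf_eq0 => /eqP.
case: (I3P j) => ->; [|exact: v1|exact: v2].
by have := uE 0; rewrite v1 mulr0 addr0 U0.
Qed.

(** * Closed spacelike geodesics through a point *)

Section ClosedFamily.
Variable p : 'rV[R]_(3 + m).
(** For momentum 1 / c^2 the rotation rate is 1, so the planar speed equals the radius and the
    closing condition reads rho^2 = 2 c^2 (1 / c^2)^2. *)
Let rho : R := Num.sqrt 2 / c.

Let rho2 : rho ^+ 2 = 2 / c ^+ 2.
Proof. by rewrite /rho expr_div_n sqr_sqrtr. Qed.

Let rho0 : 0 < rho.
Proof. by rewrite divr_gt0// sqrtr_gt0. Qed.

(* A circle of radius rho around (p_1 - rho sin s, p_2 - rho cos s), lifted with
   momentum u = 1 / c^2; this radius is the one for which the lift closes up. *)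
Let x (s : R) : 'I_(3 + m) -> R -> R := ext3
  (fun t => p 0 n0 - (p 0 n2 - rho * cos s) * (rho * (sin (s + t) - sin s))
     - c ^- 2 * (sin (s + t) * cos (s + t) - sin s * cos s))
  (fun t => p 0 n1 + rho * (sin (s + t) - sin s))
  (fun t => p 0 n2 + rho * (cos (s + t) - cos s))
  (fun i => cst (p 0 i)).

Let x' (s : R) : 'I_(3 + m) -> R -> R := ext3
  (fun t => c ^- 2 - (p 0 n2 + rho * (cos (s + t) - cos s)) * (rho * cos (s + t)))
  (fun t => rho * cos (s + t))
  (fun t => - (rho * sin (s + t)))
  (fun i => cst 0).

Let x'' (s : R) : 'I_(3 + m) -> R -> R := ext3
  (fun t => - (- (rho * sin (s + t)) * (rho * cos (s + t)) +
     (p 0 n2 + rho * (cos (s + t) - cos s)) * (rho * - sin (s + t))))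
  (fun t => rho * - sin (s + t))
  (fun t => - (rho * cos (s + t)))
  (fun i => cst 0).

Let dcos s t : is_derive t (1 : R) (fun t => cos (s + t)) (- sin (s + t)).
Proof. by have := der_cos (derD (derC s t) (derI t)); rewrite add0r mul1r. Qed.

Let dsin s t : is_derive t (1 : R) (fun t => sin (s + t)) (cos (s + t)).
Proof. by have := der_sin (derD (derC s t) (derI t)); rewrite add0r mul1r. Qed.

Let d2 s t : is_derive t (1 : R) (fun t => p 0 n2 + rho * (cos (s + t) - cos s))
  (- (rho * sin (s + t))).
Proof.
apply: (is_derive_eq (derD (derC (p 0 n2) t) (derZ rho (derB (dcos s t) (derC (cos s) t))))).
by ring.
Qed.

Let dx s i t : is_derive t (1 : R) (x s i) (x' s i t).
Proof.
have dS := derB (dsin s t) (derC (sin s) t).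
rewrite /x /x'; case: (split_ordP i) => [j|k] ->; last exact: derC.
case: (I3P j) => ->; [|apply: (is_derive_eq (derD (derC (p 0 n1) t) (derZ rho dS)))|exact: d2].
- apply: (is_derive_eq (derB (derB (derC (p 0 n0) t) (derZ (p 0 n2 - rho * cos s) (derZ rho dS)))
    (derZ (c ^- 2) (derB (derM (dsin s t) (dcos s t)) (derC (sin s * cos s) t))))).
  rewrite /ext3 /=; have := cos2Dsin2 (s + t).
  move: (cos (s + t)) (sin (s + t)) => C S CS.
  (* Writing the momentum as c^-2 (C^2 + S^2) turns the claim into an algebraic identity, given the
     value of rho^2. *)
  have -> : c ^- 2 - (p 0 n2 + rho * (C - cos s)) * (rho * C) =
    c ^- 2 * (C ^+ 2 + S ^+ 2) - (p 0 n2 - rho * cos s) * (rho * C) - rho ^+ 2 * C ^+ 2.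
    by rewrite CS; ring.
  by rewrite rho2; field; rewrite gt_eqF.
- by rewrite /ext3 /=; ring.
Qed.

Let dx' s i t : is_derive t (1 : R) (x' s i) (x'' s i t).
Proof.
rewrite /x' /x''; case: (split_ordP i) => [j|k] ->; last exact: derC.
case: (I3P j) => ->.
- apply: (is_derive_eq (derB (derC (c ^- 2) t) (derM (d2 s t) (derZ rho (dcos s t))))).
  by rewrite /ext3 /= sub0r.
- exact: (derZ rho (dcos s t)).
- exact: (derN (derZ rho (dsin s t))).
Qed.

Let smooth_x (V : normedModType R) (a b : V -> R) i : smooth a -> smooth b ->
  smooth (fun y => x (a y) i (b y)).
Proof.
move=> s1 s2; have sk k := @smooth_cst R V k; have sp := smoothD s1 s2.
have ss1 := smooth_comp (@smooth_sin R) s1; have sc1 := smooth_comp (@smooth_cos R) s1.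
have ss := smooth_comp (@smooth_sin R) sp; have sc := smooth_comp (@smooth_cos R) sp.
rewrite /x; case: (split_ordP i) => [j|k] ->; last exact: sk.
case: (I3P j) => ->.
- have h1 := smoothM (smoothB (sk (p 0 n2)) (smoothZ rho sc1)) (smoothZ rho (smoothB ss ss1)).
  have h2 := smoothZ (c ^- 2) (smoothB (smoothM ss sc) (smoothM ss1 sc1)).
  exact: (smoothB (smoothB (sk (p 0 n0)) h1) h2).
- exact: (smoothD (sk (p 0 n1)) (smoothZ rho (smoothB ss ss1))).
- exact: (smoothD (sk (p 0 n2)) (smoothZ rho (smoothB sc sc1))).
Qed.

Theorem closed_spacelike_family :
  family_of_closed_spacelike_geodesics_through (g c m) p.
Proof.
pose Gam s t : 'rV[R]_(3 + m) := \row_i x s i t.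
exists 0, 1, Gam; split; first exact: ltr01.
- apply: smooth_on_row => i; rewrite (_ : (fun st => _) = fun st : R * R => x st.1 i st.2).
    by apply: smooth_x; [exact: smooth_fst|exact: smooth_snd].
  by apply/funext => st; rewrite mxE.
- move=> s _; split.
  + split.
    * apply: (@is_geodesic_row _ (x s) (x' s) (x'' s)) => // i.
        exact: (smooth_x i (smooth_cst s) (@smooth_id R)).
      move=> t.
      rewrite /x /x' /x'' /ext3; have cn : c != 0 by rewrite gt_eqF.
      by case: i => [[|[|[|i]]] hi] /=; field.
    * exists (pi *+ 2); first by rewrite pmulrn_lgt0// pi_gt0.
      move=> t; have es : sin (s + (t + pi *+ 2)) = sin (s + t) by rewrite addrA sinD2pi.
      have ec : cos (s + (t + pi *+ 2)) = cos (s + t) by rewrite addrA cosD2pi.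
      apply/rowP => i; rewrite !mxE /x; case: (split_ordP i) => [j|k] -> //.
      by case: (I3P j) => ->; rewrite /ext3 /= ?es ?ec.
    * exists (- s), (pi / 2 - s) => /rowP/(_ n1); rewrite !mxE /x /ext3 /=.
      rewrite subrr sin0 addrCA subrr addr0 sin_pihalf => /addrI/(mulfI (lt0r_neq0 rho0)).
      by move=> /addIr/eqP; rewrite eq_sym oner_eq0.
  + move=> t; rewrite /spacelike ev2_g// (derive1_rowE (fun i => dx s i t)) !mxE.
    rewrite /x2 mxE /x /x' /ext3 /= big1 => [|k _]; last by rewrite mxE expr0n.
    have := cos2Dsin2 (s + t); set C := cos (s + t); set S := sin (s + t) => CS.
    have -> : - (c * (c ^- 2 - (p 0 n2 + rho * (C - cos s)) * (rho * C) +
        (p 0 n2 + rho * (C - cos s)) * (rho * C))) ^+ 2 + (rho * C) ^+ 2 +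
        (- (rho * S)) ^+ 2 + 0 = - (c * c ^- 2) ^+ 2 + rho ^+ 2 * (C ^+ 2 + S ^+ 2) by ring.
    rewrite CS rho2; have -> : - (c * c ^- 2) ^+ 2 + 2 / c ^+ 2 * 1 = c ^- 2.
      by field; rewrite gt_eqF.
    by rewrite invr_gt0 exprn_gt0.
  + exists 0; apply/rowP => i; rewrite mxE /x; case: (split_ordP i) => [j|k] -> //.
    by case: (I3P j) => ->; rewrite /ext3 /= addr0 !subrr !mulr0 ?subr0 ?addr0.
(* The largest x1 on the curve s is p_1 + rho (1 - sin s), taken at t = pi / 2 - s. Equal ranges
   thus force equal sines, and the sine is injective on the parameter interval since 1 <= pi / 2. *)
- have sin_le s s' : range (Gam s) `<=` range (Gam s') -> sin s' <= sin s.
    move=> /(_ (Gam s (pi / 2 - s)))[|t _ /rowP/(_ n1)].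
      by exists (pi / 2 - s).
    rewrite !mxE /x /ext3 /= addrCA subrr addr0 sin_pihalf.
    move=> /addrI/(mulfI (lt0r_neq0 rho0)) E.
    by have := sin_le1 (s' + t); lra.
  move=> s s' /andP[s0 s1] /andP[s'0 s'1] ss' E; apply: ss'.
  apply: sin_inj; rewrite ?in_itv /=.
  + by have := pihalf_ge1 R; lra.
  + by have := pihalf_ge1 R; lra.
  + by apply/eqP; rewrite eq_le !sin_le ?E.
Qed.

End ClosedFamily.

End Equations.
End Geodesics.

Theorem mainTheorem2 (R : realType) (m : nat) (c : R) (c_gt0 : 0 < c) :
  (* (1) *)
  [/\ diffeomorphism (phi c m),
      forall x : 'rV[R]_(3 + m),
        g c m x = (1 / c ^+ 2) *: pullback (phi c m) (g 1 m) x &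
      isometric (fun x : 'rV[R]_(3 + m) => c ^+ 2 *: g c m x) (g 1 m)] /\
  (* (2) *)
  geodesically_complete (g c m) /\
  (* (3) *)
  ((~ exists gamma : R -> 'rV[R]_(3 + m),
        closed_geodesic (g c m) gamma /\
        causal_curve (g c m) gamma) /\
   (forall p : 'rV[R]_(3 + m),
      family_of_closed_spacelike_geodesics_through (g c m) p)) /\
  (* (4) *)
  ((forall (r : regularity) (a b : R) (w : R -> 'rV[R]_3),
      reg_le 1 r -> a < b -> timelike_path (g3 c) r a b w ->
      exists (a' b' : R) (w' : R -> 'rV[R]_3),
        [/\ a' <= a, b <= b',
            forall t, a <= t <= b -> w' t = w t &
            closed_timelike_path (g3 c) r a' b' w']) /\
   (forall (r : regularity) (p : 'rV[R]_(3 + m)),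
      reg_le 1 r ->
      exists (a b : R) (w : R -> 'rV[R]_(3 + m)),
        [/\ a < b, closed_timelike_path (g c m) r a b w &
            exists2 t, a <= t <= b & w t = p])) /\
  (* (5) *)
  (timelike_convergence (g c m) /\
   forall Lambda : R, Lambda <= c ^+ 2 / 4 ->
     dominant_energy (g c m) Lambda).
Proof.
split; [split|split; [|split; [split|split; [split|split]]]].
- exact: diffeomorphism_phi.
- by move=> x; rewrite pullback_phi// scalerA div1r mulVf ?scale1r// expf_neq0// gt_eqF.
- by exists (phi c m); split=> [|x]; [exact: diffeomorphism_phi|rewrite pullback_phi].
- exact: geodesically_complete_g.
- exact: no_closed_causal_geodesic.
- by move=> p; exact: closed_spacelike_family.
- by move=> r a b w; exact: timelike_extension.
- by move=> r p; exact: closed_timelike_through.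
- exact: timelike_convergence_g.
- by move=> L; exact: dominant_energy_g.
Qed.
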